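(* Let $n,m\in\mathbb{Z}_{\ge 1}$, and for $k\ge 1$ let $H_k=\mathbb{R}^k/O(k)$ be the orbit space with the quotient diffeology, with $0\in H_k$ the image of the origin. Then the $(H_m,0)$-right tangent space of $(H_n,0)$ satisfies $$\hat{T}^{(H_m,0)}_0(H_n)\cong\begin{cases}\mathbb{R}, & \text{if } m\le n,\\ 0, & \text{if } m>n.\end{cases}$$
   Context: Diffeological spaces. A parametrization of a set $X$ is a map $U\to X$ with $U$ an open subset of some $\mathbb{R}^n$, $n\ge 0$. A diffeology on $X$ is a set of parametrizations, called plots, such that: (Covering) every constant parametrization is a plot; (Locality) a parametrization $p:U\to X$ is a plot if $U$ has an open cover $\{U_i\}$ with every $p|_{U_i}$ a plot; (Smooth compatibility) if $p:U\to X$ is a plot, $V\subset\mathbb{R}^m$ is open and $f:V\to U$ is smooth, then $p\circ f$ is a plot. A diffeological space is a set with a diffeology. A map $f:X\to Y$ of diffeological spaces is smooth if $f\circ p$ is a plot of $Y$ for every plot $p$ of $X$. Smooth manifolds carry the standard diffeology (plots are the smooth maps from Euclidean open sets). The $D$-topology on $X$ is the finest topology making all plots continuous. For an equivalence relation $\sim$ on $X$, the quotient diffeology on $X/\!\sim$ consists of the parametrizations $p:U\to X/\!\sim$ such that each point of $U$ has a neighborhood $U'$ with $p|_{U'}=\pi\circ q$ for some plot $q:U'\to X$, where $\pi:X\to X/\!\sim$ is the quotient map. Category. $\mathrm{Dflg}_*^{loc}$ is the category whose objects are based diffeological spaces $(X,x)$ and whose morphisms are germs at the basepoint (with respect to the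 $D$-topology) of basepoint-preserving smooth maps. Right tangent space. For a based diffeological space $(X,x)$, let $G(X,x)$ be the $\mathbb{R}$-algebra of germs at $x$ (with respect to the $D$-topology) of smooth real-valued functions. The right tangent space $\hat{T}^R_x(X)$ is the real vector space of $\mathbb{R}$-linear maps $D:G(X,x)\to\mathbb{R}$ satisfying $D(gh)=g(x)D(h)+h(x)D(g)$ for all $g,h\in G(X,x)$. A morphism $f:(Y,y)\to(X,x)$ in $\mathrm{Dflg}_*^{loc}$ induces the linear map $\hat{T}^R(f):\hat{T}^R_y(Y)\to\hat{T}^R_x(X)$, $(\hat{T}^R(f)D)(g)=D(g\circ f)$. $(Y,y)$-right tangent space. For based diffeological spaces $(X,x)$ and $(Y,y)$, $\hat{T}^{(Y,y)}_x(X)\subset\hat{T}^R_x(X)$ is the linear span of all elements $\hat{T}^R(f)D$ with $f:(Y,y)\to(X,x)$ a morphism in $\mathrm{Dflg}_*^{loc}$ and $D\in\hat{T}^R_y(Y)$. $O(k)$ is the orthogonal group acting on $\mathbb{R}^k$ in the standard way, and $H_k=\mathbb{R}^k/O(k)$ has the quotient diffeology induced from the standard diffeology of $\mathbb{R}^k$. $\cong$ means isomorphism of real vector spaces. *)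

(* Defs.v *)
From HB Require Import structures.
From mathcomp Require Import all_boot all_order all_algebra sesquilinear generic_quotient.
From mathcomp Require Import ring.
From mathcomp Require Import boolp classical_sets functions reals interval_inference.
From mathcomp Require Import topology prodnormedzmodule tvs normedtype landau derive.
Set Implicit Arguments. Unset Strict Implicit. Unset Printing Implicit Defensive.
Import Order.TTheory GRing.Theory Num.Theory numFieldNormedType.Exports.
Local Open Scope classical_set_scope.
Local Open Scope quotient_scope.
Local Open Scope ring_scope.

Section Ck.
Variables (R : realType).

(* On an open set U of 'rV[R]_n this is the usual class C^k: Frechet
   differentiability together with C^(k-1) directional derivatives. Values of f
   outside U are irrelevant (Ck_ext). *)
Fixpoint Ck (k : nat) (E V : normedModType R) (U : set E) (f : E -> V) : Prop :=
  if k is k'.+1 then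
    (forall x, U x -> differentiable f x) /\ forall v, Ck k' U ('D_v f)
  else forall x, U x -> {for x, continuous f}.

Definition smooth_on (E V : normedModType R) (U : set E) (f : E -> V) : Prop :=
  forall k, Ck k U f.

Lemma near0_differentiable (E V : normedModType R) (h : E -> V) x :
  (\near x, h x = 0) -> differentiable h x.
Proof.
move=> h0.
have E0 : h \o shift x = cst (h x) + \0 +o_ 0 id.
  rewrite (nbhs_singleton h0).
  have -> : cst 0 + \0 = 0 :> (E -> V) by apply/funext => y; rewrite /= !fctE addr0.
  apply/eqaddoE; rewrite add0r; apply/eqoP => _/posnumP[e].
  have /nbhs_ballP[d /= d0 hd] := h0.
  apply/nbhs_ballP; exists d => //= y; rewrite -ball_normE /= sub0r normrN => yd.
  rewrite hd ?normr0 ?mulr_ge0 //.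
  by rewrite -ball_normE /= opprD addrCA subrr addr0 normrN.
have d0 : 'd h x = (\0 : {linear E -> V}) :> (E -> V).
  by apply: diff_unique => //; exact: cst_continuous.
by apply/diff_locallyP; rewrite d0; split => //; exact: cst_continuous.
Qed.

Lemma near_eq_differentiable (E V : normedModType R) (f g : E -> V) x :
  (\near x, f x = g x) -> differentiable f x -> differentiable g x.
Proof.
move=> fg df; have -> : g = f + (g - f) by rewrite addrC subrK.
apply: differentiableD => //; apply: near0_differentiable.
by apply: filterS fg => y /= fgy; rewrite !fctE fgy subrr.
Qed.

Implicit Types E V W : normedModType R.

Lemma eq_near_open E (T : Type) (U : set E) (f g : E -> T) x : open U ->
  (forall x, U x -> f x = g x) -> U x -> \near x, f x = g x.
Proof. by move=> oU fg Ux; apply: filterS (open_nbhs_nbhs (conj oU Ux)). Qed.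

Lemma Ck_ext k E V (U : set E) (f g : E -> V) : open U ->
  (forall x, U x -> f x = g x) -> Ck k U f -> Ck k U g.
Proof.
move=> oU; elim: k f g => [|k IH] f g fg /=.
  move=> cf x Ux; rewrite /prop_for /continuous_at -(fg x Ux).
  apply: cvg_trans (cf x Ux); apply: near_eq_cvg; exact: eq_near_open oU fg Ux.
move=> [df Df]; split=> [x Ux|v].
  by apply: near_eq_differentiable (df x Ux); exact: eq_near_open oU fg Ux.
apply: IH (Df v) => x Ux; apply: near_eq_derive; exact: eq_near_open oU fg Ux.
Qed.

Lemma Ck_subset k E V (U U' : set E) (f : E -> V) : U' `<=` U ->
  Ck k U f -> Ck k U' f.
Proof.
move=> sub; elim: k f => [|k IH] f /=; first by move=> cf x /sub/cf.
by move=> [df Df]; split=> [x /sub/df//|v]; exact: IH.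
Qed.

Lemma Ck_local k E V (U : set E) (f : E -> V) :
  (forall x, U x -> exists2 U', U' x & Ck k U' f) -> Ck k U f.
Proof.
elim: k f => [|k IH] f /= H; first by move=> x /H[U' U'x]; apply.
split=> [x /H[U' U'x [df _]]|v]; first exact: df.
by apply: IH => x /H[U' U'x [_ Df]]; exists U'.
Qed.

Lemma Ck_pred k E V (U : set E) (f : E -> V) : Ck k.+1 U f -> Ck k U f.
Proof.
elim: k f => [|k IH] f /= [df Df]; last by split=> // v; exact/IH/Df.
by move=> x Ux; apply: differentiable_continuous; exact: df.
Qed.

Lemma Ck_cst k E V (U : set E) (a : V) : Ck k U (cst a : E -> V).
Proof.
elim: k a => [|k IH] a /=; first by move=> x _; exact: cst_continuous.
split=> // v; rewrite [X in Ck _ _ X](_ : _ = cst 0) //.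
by apply/funext => x; rewrite derive_cst.
Qed.

Lemma Ck_lin k E V (U : set E) (f : {linear E -> V}) : continuous f ->
  Ck k U (f : E -> V).
Proof.
move=> cf; case: k => [|k] /=; first by move=> x _; exact: cf.
split=> [x _|v]; first exact: linear_differentiable.
rewrite [X in Ck _ _ X](_ : _ = cst (f v)); first exact: Ck_cst.
by apply/funext => x; rewrite deriveE ?diff_lin //; exact: linear_differentiable.
Qed.

Lemma Ck_id k E (U : set E) : Ck k U (id : E -> E).
Proof. by apply: (Ck_lin k U (f := idfun)) => x; exact: cvg_id. Qed.

Lemma Ck_add k E V (U : set E) (f g : E -> V) : open U ->
  Ck k U f -> Ck k U g -> Ck k U (fun x => f x + g x).
Proof.
move=> oU; elim: k f g => [|k IH] f g /=.
  by move=> cf cg x Ux; apply: continuousD; [exact: cf|exact: cg].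
move=> [df Df] [dg Dg]; split=> [x Ux|v].
  by apply: differentiableD; [exact: df|exact: dg].
apply: Ck_ext (IH _ _ (Df v) (Dg v)) => // x Ux.
by rewrite -deriveD //; apply: diff_derivable; [exact: df|exact: dg].
Qed.

Lemma Ck_sum k E V (U : set E) n (f : 'I_n -> E -> V) : open U ->
  (forall i, Ck k U (f i)) -> Ck k U (fun x => \sum_i f i x).
Proof.
move=> oU; elim: n f => [|n IH] f Hf.
  by apply: Ck_ext (Ck_cst k U 0) => // x _; rewrite big_ord0.
have := Ck_add oU (Hf ord0) (IH (fun i => f (lift ord0 i)) (fun i => Hf _)).
by apply: Ck_ext => // x _; rewrite big_ord_recl.
Qed.

Section scale.
Variable V : normedModType R.
Let scale_is_bilinear : bilinear_for
  (GRing.Scale.Law.clone _ _ *:%R _) (GRing.Scale.Law.clone _ _ *:%R _)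
  (@GRing.scale R V : R -> V -> V).
Proof.
split=> [u'|u] a x y /=; first by rewrite scalerDl scalerA.
by rewrite scalerDr !scalerA mulrC.
Qed.
#[local] HB.instance Definition _ := bilinear_isBilinear.Build R R V V _ _
  (@GRing.scale R V) scale_is_bilinear.

Lemma differentiable_scale E (a : E -> R) (f : E -> V) x :
  differentiable a x -> differentiable f x ->
  is_diff x (fun x => a x *: f x) (fun v => a x *: 'd f x v + 'd a x v *: f x).
Proof.
move=> da df.
pose s : {bilinear R -> V -> V} := (@GRing.scale R V).
have sc : continuous (fun p : R * V => s p.1 p.2) by exact: scale_continuous.
have -> : (fun x => a x *: f x) = (fun p : R * V => s p.1 p.2) \o (fun y => (a y, f y)) by [].
have dp := differentiable_pair da df.
have ds := differentiable_bilin (a x, f x) sc.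
apply: DiffDef; first exact: differentiable_comp.
by rewrite diff_comp // diff_bilin // diff_pair.
Qed.
End scale.

Lemma Ck_scale k E V (U : set E) (a : E -> R) (f : E -> V) : open U ->
  Ck k U a -> Ck k U f -> Ck k U (fun x => a x *: f x).
Proof.
move=> oU; elim: k a f => [|k IH] a f /=.
  by move=> ca cf x Ux; apply: cvgZ; [exact: ca|exact: cf].
move=> aS fS; have [[da Da] [df Df]] := (aS, fS); split=> [x Ux|v].
  by have [] := differentiable_scale (da _ Ux) (df _ Ux).
have := Ck_add oU (IH _ _ (Ck_pred aS) (Df v)) (IH _ _ (Da v) (Ck_pred fS)).
apply: Ck_ext => // x Ux.
have [dax dfx] := (da _ Ux, df _ Ux).
have [ds Ds] := differentiable_scale dax dfx.
by rewrite [RHS]deriveE // Ds !deriveE.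
Qed.

Lemma Ck_coord k n E (U : set E) (h : E -> 'rV[R]_n) (j : 'I_n) : open U ->
  Ck k U h -> Ck k U (fun x => h x 0 j).
Proof.
move=> oU; have lj : linear (fun M : 'rV[R]_n => M 0 j).
  by move=> a M N; rewrite !mxE.
pose l : {linear 'rV[R]_n -> R} := HB.pack (fun M : 'rV[R]_n => M 0 j)
  (GRing.isLinear.Build _ _ _ _ _ lj).
have cl : continuous l by exact: coord_continuous.
have dl y : differentiable l y by exact: linear_differentiable.
elim: k h => [|k IH] h /=.
  by move=> ch x Ux; apply: (@continuous_comp _ _ _ h l) (ch x Ux) (cl _).
move=> [dh Dh]; split=> [x Ux|w].
  by apply: (@differentiable_comp _ _ _ _ h l) => //; exact: dh.
apply: Ck_ext (IH _ (Dh w)) => // x Ux.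
rewrite [RHS]deriveE; last by apply: (@differentiable_comp _ _ _ _ h l) => //; exact: dh.
rewrite (@diff_comp _ _ _ _ h l) //; last exact: dh.
by rewrite (@diff_lin _ _ _ l) //= deriveE //; exact: dh.
Qed.

Lemma Ck_comp k n E V (U : set E) (U' : set 'rV[R]_n) (f : E -> 'rV[R]_n)
    (g : 'rV[R]_n -> V) : open U -> open U' -> (forall x, U x -> U' (f x)) ->
  Ck k U f -> Ck k U' g -> Ck k U (fun x => g (f x)).
Proof.
move=> oU oU' UU'; elim: k V f g UU' => [|k IH] V f g UU' /=.
  move=> cf cg x Ux; apply: (@continuous_comp _ _ _ f g); first exact: cf.
  by apply: cg; exact: UU'.
move=> fS gS; have [[df Df] [dg Dg]] := (fS, gS); split=> [x Ux|v].
  by apply: (differentiable_comp (df _ Ux)); apply: dg; exact: UU'.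
have : Ck k U (fun x => \sum_(j < n) ('D_v f x) 0 j *: 'D_(delta_mx 0 j) g (f x)).
  apply: Ck_sum => // j; apply: Ck_scale => //; last exact: IH (Ck_pred fS) (Dg _).
  exact: Ck_coord.
apply: Ck_ext => // x Ux.
have dfx := df _ Ux; have dgx := dg _ (UU' _ Ux).
rewrite [RHS]deriveE; last exact: (differentiable_comp dfx dgx).
rewrite (@diff_comp _ _ _ _ f g) //= -(deriveE v dfx) [in RHS](row_sum_delta ('D_v f x)) linear_sum.
by apply: eq_bigr => j _; rewrite linearZ /= (deriveE _ dgx).
Qed.

End Ck.
(* A parametrization U -> X is encoded by its domain U and a total function
   'rV[R]_n -> X whose values outside U are irrelevant (plot_ext); since X will
   always be based, hence nonempty, every parametrization arises this way. In
   plot_local, the sets U' (open by plot_open) form the open cover of U. *)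
Record diffeology (R : realType) (X : Type) := Diffeology {
  plot : forall n, set 'rV[R]_n -> ('rV[R]_n -> X) -> Prop;
  plot_open : forall n (U : set 'rV[R]_n) (p : 'rV[R]_n -> X),
    plot U p -> open U;
  plot_ext : forall n (U : set 'rV[R]_n) (p q : 'rV[R]_n -> X),
    (forall u, U u -> p u = q u) -> plot U p -> plot U q;
  plot_cst : forall n (U : set 'rV[R]_n) (x : X), open U -> plot U (cst x);
  plot_local : forall n (U : set 'rV[R]_n) (p : 'rV[R]_n -> X), open U ->
    (forall u, U u -> exists U' : set 'rV[R]_n,
       [/\ U' u, U' `<=` U & plot U' p]) -> plot U p;
  plot_smooth : forall m n (V : set 'rV[R]_m) (U : set 'rV[R]_n)
      (f : 'rV[R]_m -> 'rV[R]_n) (p : 'rV[R]_n -> X),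
    open V -> smooth_on V f -> (forall v, V v -> U (f v)) ->
    plot U p -> plot V (p \o f)
}.

Record dflgType (R : realType) := DflgType {
  dflg_sort :> Type;
  dflg_str :> diffeology R dflg_sort
}.

Section Standard.
Variables (R : realType) (V : normedModType R).

(* For V = 'rV[R]_k or V = R^o this is the standard diffeology of the manifold. *)
Definition std_plot n (U : set 'rV[R]_n) (p : 'rV[R]_n -> V) : Prop :=
  open U /\ smooth_on U p.

Fact std_plot_ext n (U : set 'rV[R]_n) (p q : 'rV[R]_n -> V) :
  (forall u, U u -> p u = q u) -> std_plot U p -> std_plot U q.
Proof. by move=> pq [oU sp]; split=> // k; exact: Ck_ext (sp k). Qed.

Fact std_plot_local n (U : set 'rV[R]_n) (p : 'rV[R]_n -> V) : open U ->
  (forall u, U u -> exists U' : set 'rV[R]_n,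
     [/\ U' u, U' `<=` U & std_plot U' p]) -> std_plot U p.
Proof.
move=> oU H; split=> // k; apply: Ck_local => u /H[U' [U'u _ [_ sp]]].
by exists U'.
Qed.

Fact std_plot_smooth m n (W : set 'rV[R]_m) (U : set 'rV[R]_n)
    (f : 'rV[R]_m -> 'rV[R]_n) (p : 'rV[R]_n -> V) :
  open W -> smooth_on W f -> (forall w, W w -> U (f w)) ->
  std_plot U p -> std_plot W (p \o f).
Proof. by move=> oW sf WU [oU sp]; split=> // k; exact: (Ck_comp oW oU WU). Qed.

Definition std_diffeology : diffeology R V := {|
  plot := std_plot;
  plot_open := fun n U p => @proj1 _ _;
  plot_ext := std_plot_ext;
  plot_cst := fun n U x oU => conj oU (fun k => Ck_cst k U x);
  plot_local := std_plot_local;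
  plot_smooth := std_plot_smooth |}.

Definition std_dflg : dflgType R := DflgType std_diffeology.

End Standard.

Section Quotient.
Variables (R : realType) (T : choiceType) (d : diffeology R T).
Variable e : equiv_rel T.

Definition quot_plot n (U : set 'rV[R]_n) (p : 'rV[R]_n -> {eq_quot e}) : Prop :=
  open U /\ forall u, U u -> exists (U' : set 'rV[R]_n) (q : 'rV[R]_n -> T),
    [/\ U' u, U' `<=` U, plot d U' q & forall w, U' w -> p w = \pi_({eq_quot e}) (q w)].

Fact quot_plot_ext n (U : set 'rV[R]_n) (p q : 'rV[R]_n -> {eq_quot e}) :
  (forall u, U u -> p u = q u) -> quot_plot U p -> quot_plot U q.
Proof.
move=> pq [oU H]; split=> // u /H[U' [s [U'u U'U ps E]]].
by exists U', s; split=> // w U'w; rewrite -pq ?E //; exact: U'U.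
Qed.

Fact quot_plot_cst n (U : set 'rV[R]_n) (x : {eq_quot e}) :
  open U -> quot_plot U (cst x).
Proof.
move=> oU; split=> // u Uu; exists U, (cst (repr x)).
by split=> // [|w _]; [exact: plot_cst|rewrite reprK].
Qed.

Fact quot_plot_local n (U : set 'rV[R]_n) (p : 'rV[R]_n -> {eq_quot e}) :
  open U ->
  (forall u, U u -> exists U' : set 'rV[R]_n,
     [/\ U' u, U' `<=` U & quot_plot U' p]) -> quot_plot U p.
Proof.
move=> oU H; split=> // u /H[U' [U'u U'U [_ /(_ u U'u)[U'' [q [? s ? ?]]]]]].
by exists U'', q; split=> // w /s/U'U.
Qed.

Lemma smooth_open_preimage m n (V : set 'rV[R]_m) (U : set 'rV[R]_n)
    (f : 'rV[R]_m -> 'rV[R]_n) :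
  open V -> smooth_on V f -> open U -> open (V `&` f @^-1` U).
Proof.
move=> oV sf oU; rewrite openE => v [Vv Ufv]; apply: filterI.
  by move: oV; rewrite openE; apply.
apply: (sf 0%N v Vv).
by move: oU; rewrite openE; apply.
Qed.

Fact quot_plot_smooth m n (V : set 'rV[R]_m) (U : set 'rV[R]_n)
    (f : 'rV[R]_m -> 'rV[R]_n) (p : 'rV[R]_n -> {eq_quot e}) :
  open V -> smooth_on V f -> (forall v, V v -> U (f v)) ->
  quot_plot U p -> quot_plot V (p \o f).
Proof.
move=> oV sf VU [oU H]; split=> // v Vv.
have [U' [q [U'fv U'U pq E]]] := H _ (VU _ Vv).
exists (V `&` f @^-1` U'), (q \o f); split; [by []|by move=> w []| |by move=> w [_]; exact: E].
apply: (plot_smooth _ _ _ pq) => [||w []//].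
  exact: smooth_open_preimage (plot_open pq).
by move=> k; apply: Ck_subset (sf k) => w [].
Qed.

Definition quot_diffeology : diffeology R {eq_quot e} := {|
  plot := quot_plot;
  plot_open := fun n U p => @proj1 _ _;
  plot_ext := quot_plot_ext;
  plot_cst := quot_plot_cst;
  plot_local := quot_plot_local;
  plot_smooth := quot_plot_smooth |}.

Definition quot_dflg : dflgType R := DflgType quot_diffeology.

End Quotient.

Section LocalMaps.
Variable R : realType.
Implicit Types X Y Z : dflgType R.

Definition D_open X (A : set X) : Prop :=
  forall n (U : set 'rV[R]_n) (p : 'rV[R]_n -> X),
    plot X U p -> open (U `&` p @^-1` A).

(* Smoothness of the restriction of f to A, for the subset diffeology on A: its
   plots are the plots of X with values in A. *)
Definition smooth_in X Y (A : set X) (f : X -> Y) : Prop :=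
  forall n (U : set 'rV[R]_n) (p : 'rV[R]_n -> X),
    plot X U p -> (forall u, U u -> A (p u)) -> plot Y U (f \o p).

Definition D_nbhs X (x : X) (A : set X) : Prop := D_open A /\ A x.

Definition smooth_near X Y (x : X) (f : X -> Y) : Prop :=
  exists2 A, D_nbhs x A & smooth_in A f.

Lemma D_nbhsT X (x : X) : D_nbhs x setT.
Proof. by split=> // n U p pp; rewrite setIT; exact: plot_open pp. Qed.

Lemma D_nbhsI X (x : X) (A B : set X) :
  D_nbhs x A -> D_nbhs x B -> D_nbhs x (A `&` B).
Proof.
move=> [oA Ax] [oB Bx]; split=> // n U p pp.
by rewrite preimage_setI setIIr; apply: openI; [exact: oA|exact: oB].
Qed.

Lemma smooth_inS X Y (A B : set X) (f : X -> Y) :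
  A `<=` B -> smooth_in B f -> smooth_in A f.
Proof. by move=> AB sf n U p pp pA; apply: sf => // u /pA/AB. Qed.

Lemma plot_restrict X (A : set X) n (U : set 'rV[R]_n) (p : 'rV[R]_n -> X) :
  D_open A -> plot X U p -> plot X (U `&` p @^-1` A) p.
Proof.
move=> oA pp; apply: (plot_smooth (f := id) _ _ _ pp) => [||v []//].
  exact: oA.
by move=> k; exact: Ck_id.
Qed.

Lemma D_nbhs_preimage X Y (A : set X) (B : set Y) (f : X -> Y) x :
  D_nbhs x A -> smooth_in A f -> D_nbhs (f x) B -> D_nbhs x (A `&` f @^-1` B).
Proof.
move=> [oA Ax] sf [oB Bfx]; split=> // n U p pp.
have := oB _ _ _ (sf _ _ _ (plot_restrict oA pp) (fun u => @proj2 _ _)).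
by rewrite preimage_setI setIA.
Qed.

Lemma smooth_near_comp X Y Z (x : X) (f : X -> Y) (g : Y -> Z) :
  smooth_near x f -> smooth_near (f x) g -> smooth_near x (g \o f).
Proof.
move=> [A nA sf] [B nB sg]; exists (A `&` f @^-1` B).
  exact: D_nbhs_preimage.
move=> n U p pp pAB; apply: (sg _ _ (f \o p)) => [|u /pAB[]//].
by apply: sf => // u /pAB[].
Qed.

Lemma smooth_near_cst X Y (x : X) (y : Y) : smooth_near x (cst y : X -> Y).
Proof.
exists setT; first exact: D_nbhsT.
by move=> n U p pp _; apply: plot_cst; exact: plot_open pp.
Qed.

(* A smooth map defined on some D-open neighbourhood of x, encoded by a total
   function with arbitrary values elsewhere; the neighbourhood is forgotten
   since only germs matter. *)
Record local_map X (x : X) Y := LocalMap {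
  local_fun :> X -> Y;
  local_mapP : smooth_near x local_fun
}.

Definition germ_rel X (x : X) Y : rel {classic local_map x Y} :=
  fun f g => `[< exists2 A, D_nbhs x A & forall z, A z -> f z = g z >].

Fact germ_rel_equiv X (x : X) Y : equiv_class_of (@germ_rel X x Y).
Proof.
split=> [f|f g|g f h].
- by apply/asboolP; exists setT => //; exact: D_nbhsT.
- by apply/asboolP/asboolP => -[A nA fg]; exists A => // z Az; rewrite fg.
- move=> /asboolP[A nA fg] /asboolP[B nB gh]; apply/asboolP.
  exists (A `&` B); first exact: D_nbhsI.
  by move=> z [Az Bz]; rewrite fg // gh.
Qed.

Canonical germ_equiv X (x : X) Y := EquivRelPack (@germ_rel_equiv X x Y).

Definition germ X (x : X) Y : Type := {eq_quot @germ_equiv X x Y}.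
HB.instance Definition _ X (x : X) Y :=
  Choice.copy (germ x Y) {eq_quot @germ_equiv X x Y}.

Definition germ_of X (x : X) Y (f : local_map x Y) : germ x Y :=
  \pi_({eq_quot @germ_equiv X x Y}) (f : {classic local_map x Y}).

Definition germ_repr X (x : X) Y (g : germ x Y) : local_map x Y :=
  repr (g : {eq_quot @germ_equiv X x Y}).

Definition germ_val X (x : X) Y (g : germ x Y) : Y := germ_repr g x.

Lemma germ_reprK X (x : X) Y : cancel (@germ_repr X x Y) (@germ_of X x Y).
Proof. by move=> g; exact: reprK. Qed.

Lemma germ_ofP X (x : X) Y (f g : local_map x Y) :
  germ_of f = germ_of g <->
  exists2 A, D_nbhs x A & forall z, A z -> f z = g z.
Proof.
by split=> [/eqmodP/asboolP//|fg]; apply/eqmodP/asboolP.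
Qed.

Lemma germ_repr_of X (x : X) Y (f : local_map x Y) :
  exists2 A, D_nbhs x A & forall z, A z -> germ_repr (germ_of f) z = f z.
Proof. by apply/germ_ofP; rewrite germ_reprK. Qed.

Lemma germ_val_of X (x : X) Y (f : local_map x Y) : germ_val (germ_of f) = f x.
Proof. by have [A [_ Ax]] := germ_repr_of f; apply. Qed.

Lemma germ_ind X (x : X) Y (P : germ x Y -> Prop) :
  (forall f, P (germ_of f)) -> forall g, P g.
Proof. by move=> H g; rewrite -(germ_reprK g). Qed.

End LocalMaps.

Record based (R : realType) := Based {
  based_sort :> dflgType R;
  basept : based_sort
}.

Section GermAlgebra.
Variables (R : realType) (X : based R).

Definition germ_alg : Type := germ (basept X) (std_dflg R^o).
HB.instance Definition _ := Choice.on germ_alg.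

Local Notation lmap := (local_map (basept X) (std_dflg R^o)).
Implicit Types f g h : lmap.

Lemma smooth_near2 (op : R -> R -> R) (f g : X -> R) :
  (forall n (U : set 'rV[R]_n) (p q : 'rV[R]_n -> R), open U ->
     smooth_on U p -> smooth_on U q -> smooth_on U (fun u => op (p u) (q u))) ->
  smooth_near (Y := std_dflg R^o) (basept X) f ->
  smooth_near (Y := std_dflg R^o) (basept X) g ->
  smooth_near (Y := std_dflg R^o) (basept X) (fun x => op (f x) (g x)).
Proof.
move=> Hop [A nA sf] [B nB sg]; exists (A `&` B); first exact: D_nbhsI.
move=> n U p pp pAB.
have [oU sfp] := sf _ _ _ pp (fun u Uu => proj1 (pAB u Uu)).
have [_ sgp] := sg _ _ _ pp (fun u Uu => proj2 (pAB u Uu)).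
by split=> //; exact: (Hop _ _ (f \o p) (g \o p)).
Qed.

Fact local_addP f g : smooth_near (Y := std_dflg R^o) (basept X) (fun x => f x + g x : R).
Proof.
apply: (smooth_near2 (op := +%R)) (local_mapP f) (local_mapP g).
by move=> n U p q oU sp sq k; exact: Ck_add.
Qed.

Fact local_mulP f g : smooth_near (Y := std_dflg R^o) (basept X) (fun x => f x * g x : R).
Proof.
apply: (smooth_near2 (op := *%R)) (local_mapP f) (local_mapP g).
by move=> n U p q oU sp sq k; exact: (Ck_scale (V := R^o)).
Qed.

Definition local_add f g : lmap := LocalMap (local_addP f g).
Definition local_mul f g : lmap := LocalMap (local_mulP f g).
Definition local_cst (c : R) : lmap :=
  LocalMap (smooth_near_cst (Y := std_dflg R^o) (basept X) c).

Definition germ_add (a b : germ_alg) : germ_alg :=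
  germ_of (local_add (germ_repr a) (germ_repr b)).
Definition germ_mul (a b : germ_alg) : germ_alg :=
  germ_of (local_mul (germ_repr a) (germ_repr b)).
Definition germ_cst (c : R) : germ_alg := germ_of (local_cst c).
Definition germ_opp (a : germ_alg) : germ_alg := germ_mul (germ_cst (-1)) a.
Definition germ_scale (c : R) (a : germ_alg) : germ_alg := germ_mul (germ_cst c) a.

Lemma germ_addE f g : germ_add (germ_of f) (germ_of g) = germ_of (local_add f g).
Proof.
have [A nA Hf] := germ_repr_of f; have [B nB Hg] := germ_repr_of g.
apply/germ_ofP; exists (A `&` B); first exact: D_nbhsI.
by move=> z [Az Bz] /=; rewrite Hf // Hg.
Qed.

Lemma germ_mulE f g : germ_mul (germ_of f) (germ_of g) = germ_of (local_mul f g).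
Proof.
have [A nA Hf] := germ_repr_of f; have [B nB Hg] := germ_repr_of g.
apply/germ_ofP; exists (A `&` B); first exact: D_nbhsI.
by move=> z [Az Bz] /=; rewrite Hf // Hg.
Qed.

Lemma eq_germ_of f g : (forall z, f z = g z) -> germ_of f = germ_of g.
Proof. by move=> fg; apply/germ_ofP; exists setT => //; exact: D_nbhsT. Qed.

Let germE := (germ_addE, germ_mulE).

Fact germ_addA : associative germ_add.
Proof.
elim/germ_ind=> f; elim/germ_ind=> g; elim/germ_ind=> h; rewrite !germE.
by apply: eq_germ_of => z /=; rewrite addrA.
Qed.
Fact germ_addC : commutative germ_add.
Proof.
elim/germ_ind=> f; elim/germ_ind=> g; rewrite !germE.
by apply: eq_germ_of => z /=; rewrite addrC.
Qed.
Fact germ_add0 : left_id (germ_cst 0) germ_add.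
Proof.
elim/germ_ind=> f; rewrite !germE.
by apply: eq_germ_of => z /=; rewrite add0r.
Qed.
Fact germ_addN : left_inverse (germ_cst 0) germ_opp germ_add.
Proof.
elim/germ_ind=> f; rewrite /germ_opp germ_mulE germ_addE.
by apply: eq_germ_of => z /=; rewrite mulN1r addNr.
Qed.
HB.instance Definition _ :=
  GRing.isZmodule.Build germ_alg germ_addA germ_addC germ_add0 germ_addN.

Fact germ_mulA : associative germ_mul.
Proof.
elim/germ_ind=> f; elim/germ_ind=> g; elim/germ_ind=> h; rewrite !germE.
by apply: eq_germ_of => z /=; rewrite mulrA.
Qed.
Fact germ_mulC : commutative germ_mul.
Proof.
elim/germ_ind=> f; elim/germ_ind=> g; rewrite !germE.
by apply: eq_germ_of => z /=; rewrite mulrC.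
Qed.
Fact germ_mul1 : left_id (germ_cst 1) germ_mul.
Proof.
elim/germ_ind=> f; rewrite !germE.
by apply: eq_germ_of => z /=; rewrite mul1r.
Qed.
Fact germ_mulDl : left_distributive germ_mul germ_add.
Proof.
elim/germ_ind=> f; elim/germ_ind=> g; elim/germ_ind=> h; rewrite !germE.
by apply: eq_germ_of => z /=; rewrite mulrDl.
Qed.
Fact germ_1neq0 : germ_cst 1 != germ_cst 0.
Proof.
apply/eqP => /(congr1 (@germ_val _ _ _ _)); rewrite !germ_val_of /= => /eqP.
by rewrite oner_eq0.
Qed.
HB.instance Definition _ := GRing.Zmodule_isComNzRing.Build germ_alg
  germ_mulA germ_mulC germ_mul1 germ_mulDl germ_1neq0.

Fact germ_scaleA (a b : R) (v : germ_alg) :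
  germ_scale a (germ_scale b v) = germ_scale (a * b) v.
Proof.
elim/germ_ind: v => f; rewrite /germ_scale (germ_mulE _ f) !germ_mulE.
by apply: eq_germ_of => z /=; rewrite mulrA.
Qed.
Fact germ_scaleDr : right_distributive germ_scale +%R.
Proof.
move=> c; elim/germ_ind=> f; elim/germ_ind=> g.
rewrite /GRing.add /= /germ_scale (germ_addE f g) !germ_mulE germ_addE.
by apply: eq_germ_of => z /=; rewrite mulrDr.
Qed.
Fact germ_scaleDl (v : germ_alg) : {morph germ_scale^~ v : a b / a + b}.
Proof.
move=> a b; elim/germ_ind: v => f.
rewrite [RHS]/GRing.add /= /germ_scale !germ_mulE germ_addE.
by apply: eq_germ_of => z /=; rewrite mulrDl.
Qed.
HB.instance Definition _ := GRing.Zmodule_isLmodule.Build R germ_alg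
  germ_scaleA germ_mul1 germ_scaleDr germ_scaleDl.
Fact germ_scaleAl (c : R) (a b : germ_alg) : c *: (a * b) = (c *: a) * b.
Proof. exact: germ_mulA. Qed.
HB.instance Definition _ :=
  GRing.Lmodule_isLalgebra.Build R germ_alg germ_scaleAl.
HB.instance Definition _ := GRing.Lalgebra_isComAlgebra.Build R germ_alg.

Definition derivation (D : germ_alg -> R^o) : Prop :=
  linear D /\
  forall g h : germ_alg, D (g * h) = germ_val g * D h + germ_val h * D g.

Definition derivation_pred : {pred germ_alg -> R^o} := fun D => `[< derivation D >].

Fact derivation_submod : submod_closed derivation_pred.
Proof.
split=> [|c D E /asboolP[lD dD] /asboolP[lE dE]]; apply/asboolP.
  split=> [c g h|g h]; first by rewrite scaler0 addr0.
  by rewrite !mulr0 addr0.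
have cDE (g : germ_alg) : (c *: D + E) g = c * D g + E g by [].
split=> [a g h|g h]; rewrite !cDE.
  by rewrite lD lE /GRing.scale /=; ring.
by rewrite dD dE; ring.
Qed.
HB.instance Definition _ :=
  GRing.isSubmodClosed.Build R (germ_alg -> R^o) derivation_pred derivation_submod.

Record rtangent := RTangent {
  rt_fun :> germ_alg -> R^o;
  rt_funP : rt_fun \in derivation_pred
}.
HB.instance Definition _ := [isSub for rt_fun].
HB.instance Definition _ := [Choice of rtangent by <:].
HB.instance Definition _ := [SubChoice_isSubLmodule of rtangent by <:].

End GermAlgebra.

(* Morphisms (Y, y) -> (X, x) of the category of based diffeological spaces and
   germs of smooth maps. *)
Record morphism (R : realType) (Y X : based R) := Morphism {
  mor_germ : germ (basept Y) X;
  mor_pt : germ_val mor_germ = basept X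
}.

Section Pushforward.
Variables (R : realType) (Y X : based R) (f : morphism Y X).

Fact precompP (g : local_map (basept X) (std_dflg R^o)) :
  smooth_near (basept Y) (g \o germ_repr (mor_germ f)).
Proof.
apply: smooth_near_comp; first exact: local_mapP.
by rewrite [X in smooth_near X](mor_pt f); exact: local_mapP.
Qed.

Definition precomp (g : germ_alg X) : germ_alg Y :=
  germ_of (LocalMap (precompP (germ_repr g))).

Lemma precompE g : precomp (germ_of g) = germ_of (LocalMap (precompP g)).
Proof.
have [B nB gB] := germ_repr_of g.
have [A nA fA] := local_mapP (germ_repr (mor_germ f)).
apply/germ_ofP; exists (A `&` germ_repr (mor_germ f) @^-1` B).
  by apply: D_nbhs_preimage => //; rewrite [X in D_nbhs X](mor_pt f).
by move=> z [_ Bz] /=; exact: gB.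
Qed.

Lemma germ_val_precomp g : germ_val (precomp g) = germ_val g.
Proof.
by rewrite germ_val_of /= [germ_repr (mor_germ f) _](mor_pt f).
Qed.

Fact precomp_linear : linear precomp.
Proof.
move=> c; elim/germ_ind=> g; elim/germ_ind=> h.
rewrite /GRing.scale /GRing.add /= /germ_scale (germ_mulE _ g) germ_addE !precompE.
rewrite germ_mulE germ_addE; exact: eq_germ_of.
Qed.

Fact precomp_mul : {morph precomp : g h / g * h}.
Proof.
elim/germ_ind=> g; elim/germ_ind=> h.
rewrite /GRing.mul /= germ_mulE !precompE germ_mulE; exact: eq_germ_of.
Qed.

Fact pushforward_derivation (D : rtangent Y) :
  (fun g => D (precomp g)) \in @derivation_pred R X.
Proof.
have /asboolP[lD dD] := rt_funP D; apply/asboolP; split=> [c g h|g h].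
  by rewrite precomp_linear lD.
by rewrite precomp_mul dD !germ_val_precomp.
Qed.

Definition pushforward (D : rtangent Y) : rtangent X :=
  RTangent (pushforward_derivation D).

Fact pushforward_linear : linear pushforward.
Proof. by move=> c D E; apply/val_inj. Qed.
HB.instance Definition _ :=
  GRing.isLinear.Build R (rtangent Y) (rtangent X) _ pushforward
    pushforward_linear.

End Pushforward.

Section Span.
Variables (R : nzRingType) (V : lmodType R).

Definition lspan (S : set V) : {pred V} := fun v =>
  `[< exists (k : nat) (c : 'I_k -> R) (w : 'I_k -> V),
        (forall i, S (w i)) /\ v = \sum_(i < k) c i *: w i >].

Fact lspan_submod (S : set V) : submod_closed (lspan S).
Proof.
split=> [|a u v /asboolP[k [c [w [Sw ->]]]] /asboolP[l [d [x [Sx ->]]]]].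
  by apply/asboolP; exists 0%N, (fun=> 0), (fun=> 0); split=> [[]//|]; rewrite big_ord0.
apply/asboolP; exists (k + l)%N,
  (fun i : 'I_(k + l) => match fintype.split i with inl i => a * c i | inr i => d i end),
  (fun i : 'I_(k + l) => match fintype.split i with inl i => w i | inr i => x i end).
split=> [i|]; first by case: (fintype.split i).
rewrite big_split_ord /= scaler_sumr; congr (_ + _).
  by apply: eq_bigr => i _; rewrite (unsplitK (inl i : 'I_k + 'I_l)) scalerA.
by apply: eq_bigr => i _; rewrite (unsplitK (inr i : 'I_k + 'I_l)).
Qed.
HB.instance Definition _ (S : set V) :=
  GRing.isSubmodClosed.Build R V (lspan S) (lspan_submod S).

End Span.

Section RelativeTangent.
Variables (R : realType) (Y X : based R).

Definition pushforwards : set (rtangent X) :=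
  [set v | exists (f : morphism Y X) (D : rtangent Y), v = pushforward f D].

(* The (Y, y)-right tangent space of (X, x), where Y and X carry their base
   points. *)
Record rel_rtangent := RelRTangent {
  rrt_val :> rtangent X;
  rrt_valP : rrt_val \in lspan pushforwards
}.
HB.instance Definition _ := [isSub for rrt_val].
HB.instance Definition _ := [Choice of rel_rtangent by <:].
HB.instance Definition _ := [SubChoice_isSubLmodule of rel_rtangent by <:].

End RelativeTangent.

Section OrbitSpace.
Variables (R : realType) (k : nat).

Definition orthogonal_mx (A : 'M[R]_k) : Prop := A^T *m A = 1%:M.

(* Row vectors stand for points of R^k, so that x *m A^T is the image A x. *)
Definition orbit_rel : rel 'rV[R]_k := fun x y =>
  `[< exists2 A, orthogonal_mx A & y = x *m A^T >].

Fact orbit_rel_equiv : equiv_class_of orbit_rel.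
Proof.
split=> [x|x y|y x z].
- apply/asboolP; exists 1%:M; first by rewrite /orthogonal_mx trmx1 mulmx1.
  by rewrite trmx1 mulmx1.
- have sym u v : orbit_rel u v -> orbit_rel v u.
    move=> /asboolP[A oA ->]; apply/asboolP; exists A^T.
      by rewrite /orthogonal_mx trmxK; exact: mulmx1C.
    by rewrite trmxK -mulmxA oA mulmx1.
  by apply/idP/idP; exact: sym.
- move=> /asboolP[A oA ->] /asboolP[B oB ->]; apply/asboolP; exists (B *m A).
    by rewrite /orthogonal_mx trmx_mul -mulmxA (mulmxA B^T) oB mul1mx.
  by rewrite trmx_mul mulmxA.
Qed.
Canonical orbit_equiv := EquivRelPack orbit_rel_equiv.

Definition orbit_space : based R :=
  @Based R (quot_dflg (std_diffeology 'rV[R]_k) orbit_equiv)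
    (\pi_({eq_quot orbit_equiv}) 0).

End OrbitSpace.

Definition lmod_iso (R : nzRingType) (V W : lmodType R) : Prop :=
  exists f : {linear V -> W}, bijective f.

(* Main.v *)
(* A smooth O(n)-invariant function f near 0 is f x = F |x| with F even and smooth,
   so F t = F 0 + t^2 * G t with G even and smooth.  Such a G again gives a smooth
   function of x: dividing the odd derivative by t yields even smooth functions
   phi_j with phi_0 = G and phi_j' t = t * phi_(j+1) t, and then the derivative of
   phi_j |x| along v is <x, v> * phi_(j+1) |x|, with no singularity at 0.  Hence
   every germ on H_n is g = g(0) + r * k with r = |x|^2, and a derivation D is
   determined by D r, through D g = k(0) * D r; the value D r = 1 occurs.
   If m <= n, the inclusion of R^m in R^n pulls r back to r, so the span is a line.
   If n < m, a morphism H_m -> H_n lifts near 0 to a smooth q : R^m -> R^n with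
   |q x|^2 = |x|^2 * k x; along a kernel vector of the differential of q at 0 this
   forces k 0 = 0, so that every pushforward kills r. *)
Require Import Defs.
From HB Require Import structures.
From mathcomp Require Import all_boot all_order all_algebra generic_quotient.
From mathcomp Require Import ring.
From mathcomp Require Import boolp classical_sets functions reals interval_inference.
From mathcomp Require Import topology normedtype landau derive realfun.
Set Implicit Arguments. Unset Strict Implicit. Unset Printing Implicit Defensive.
Import Order.TTheory GRing.Theory Num.Theory numFieldNormedType.Exports.
Local Open Scope classical_set_scope.
Local Open Scope ring_scope.

(** * Smooth even functions of one real variable *)

Section OneVariable.
Context {R : realType}.
Implicit Types (F G : R -> R) (e t : R).

(** The successive derivatives are carried as explicit functions, so that the quotients below can be
    shown smooth by writing their derivatives down. *)
Definition smooth1 e F := exists Fs : nat -> R -> R, Fs 0%N = F /\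
  forall j t, `|t| < e -> is_derive t 1 (Fs j) (Fs j.+1 t).

Lemma near_normr_lt e t : `|t| < e -> \forall x \near t, `|x| < e.
Proof. move=> te; have /cvgr_lt := @norm_continuous _ R^o t; exact. Qed.

Lemma is_derive_continuous F t d : is_derive t 1 F d -> F x @[x --> t] --> F t.
Proof. by case=> /derivable1_diffP /differentiable_continuous. Qed.

(** Nothing is asked of the derivatives at 0, but the limit of [df / dg] is taken along full
    neighbourhoods of 0, so this quotient must also have the value [l] at 0. *)
Lemma lhopital_punctured e (f df g dg : R -> R) (l : R) : 0 < e ->
  (forall t, `|t| < e -> t != 0 -> is_derive t 1 f (df t)) ->
  (forall t, `|t| < e -> t != 0 -> is_derive t 1 g (dg t)) ->
  (forall t, `|t| < e -> t != 0 -> dg t != 0) ->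
  f x @[x --> (0 : R)] --> (0 : R) -> g x @[x --> (0 : R)] --> (0 : R) ->
  df x / dg x @[x --> (0 : R)] --> l -> f x / g x @[x --> (0 : R)^'] --> l.
Proof.
move=> e0 fdf gdg dg0 f0 g0.
have itv t : t \in (`]- e, e[ `\ 0)%classic -> `|t| < e /\ t != 0.
  by rewrite inE => -[/=]; rewrite in_itv /= -ltr_norml => -> /eqP.
apply: (@lhopital R f df g dg (- e) e) => // [|t /itv[]|t /itv[]|t /itv[]].
- by rewrite in_itv /= oppr_lt0 e0.
- exact: fdf.
- exact: gdg.
- exact: dg0.
Qed.

(** The difference quotient at 0 is a quotient of two functions that tend to 0, with derivatives
    [G1] and 1, so l'Hopital's rule gives its limit. *)
Lemma is_derive_limit e G (G1 : R -> R) : 0 < e ->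
  (forall t, `|t| < e -> t != 0 -> is_derive t 1 G (G1 t)) ->
  G x @[x --> (0 : R)] --> G 0 -> G1 x @[x --> (0 : R)] --> G1 0 ->
  is_derive (0 : R) 1 G (G1 0).
Proof.
move=> e0 dG cG cG1.
have H : (G x - G 0) / x @[x --> (0 : R)^'] --> G1 0.
  apply: (@lhopital_punctured e (fun x => G x - G 0) G1 id (cst 1)) => //.
  - move=> t te t0; have := dG t te t0 => ?.
    by apply: is_derive_eq; rewrite subr0.
  - by move=> t _ _; exact: oner_neq0.
  - have := cvgB cG (cvg_cst (G 0)); rewrite subrr; exact.
  - by apply: cvg_trans cG1; apply: near_eq_cvg; near=> x; rewrite /= divr1.
have H' : h^-1 *: (G (h *: 1 + 0) - G 0) @[h --> (0 : R)^'] --> G1 0.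
  apply: cvg_trans H; apply: near_eq_cvg; near=> x.
  by rewrite addr0 [_ *: 1]mulr1 [_ *: _]mulrC.
split; first by apply/cvg_ex; exists (G1 0).
exact: (cvg_lim _ H').
Unshelve. all: by end_near. Qed.

Section Hadamard.
Variables (e : R) (Fs : nat -> R -> R).
Hypotheses (e0 : 0 < e) (Fs00 : Fs 0%N 0 = 0).
Hypothesis dFs : forall j t, `|t| < e -> is_derive t 1 (Fs j) (Fs j.+1 t).

Let e00 : `|0 : R| < e. Proof. by rewrite normr0. Qed.

(* The j-th derivative of Fs 0 t / t is hadamard_num j t / t ^ j.+1. *)
Fixpoint hadamard_num j t : R :=
  if j is i.+1 then t ^+ j * Fs j t - j%:R * hadamard_num i t else Fs 0%N t.
Local Notation E := hadamard_num.

(** For |t| < e this is the integral of s^j F^(j+1)(s t) over s in [0, 1], where F is [Fs 0]; hence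
    the value at 0. *)
Definition hadamard_quot j t : R :=
  if t == 0 then Fs j.+1 0 / j.+1%:R else E j t / t ^+ j.+1.
Local Notation G := hadamard_quot.

(** In the induction step the term (j+1) t^j [Fs j.+1 t] of the product rule cancels against the
    derivative of the subtracted numerator. *)
Lemma is_derive_hadamard_num j t : `|t| < e ->
  is_derive t 1 (E j) (t ^+ j * Fs j.+1 t).
Proof.
move=> te; elim: j => [|j IH] /=; first by rewrite mul1r; exact: dFs.
have dF := dFs j.+1 te.
have -> : (fun t => t ^+ j.+1 * Fs j.+1 t - j.+1%:R * E j t) =
    (id ^+ j.+1) * Fs j.+1 - j.+1%:R *: E j.
  by apply/funext => u; rewrite !fctE.
apply: is_derive_eq.
rewrite !exprfctE /GRing.scale /=; ring.
Qed.

Lemma hadamard_num0 j : E j 0 = 0.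
Proof. by elim: j => //= j ->; rewrite expr0n mul0r mulr0 subr0. Qed.

Lemma hadamard_quotE j t : t != 0 -> G j t = E j t / t ^+ j.+1.
Proof. by rewrite /hadamard_quot => /negbTE ->. Qed.

Lemma hadamard_quot_cont0 j : G j x @[x --> (0 : R)] --> G j 0.
Proof.
apply/continuous_withinNx; rewrite {2}/hadamard_quot eqxx.
have H : E j x / x ^+ j.+1 @[x --> (0 : R)^'] --> Fs j.+1 0 / j.+1%:R.
  (* [p] is t^j with its value at 0 changed to 1: the limit of the quotient of derivatives includes
     the point 0, where for j > 0 a denominator 0^j would yield the default value 0. *)
  pose p (t : R) : R := if t == 0 then 1 else t ^+ j.
  have p0 t : p t != 0.
    by rewrite /p; case: (eqVneq t 0) => [_|t0]; [exact: oner_neq0|exact: expf_neq0].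
  apply: (@lhopital_punctured e (E j) (fun t => p t * Fs j.+1 t) (fun t => t ^+ j.+1)
    (fun t => p t * j.+1%:R)) => //.
  - move=> t te t0; rewrite /p (negbTE t0); exact: is_derive_hadamard_num.
  - move=> t te t0; rewrite /p (negbTE t0).
    have -> : (fun t => t ^+ j.+1) = (id : R -> R) ^+ j.+1.
      by apply/funext => u; rewrite exprfctE.
    by apply: is_derive_eq; rewrite /= /GRing.scale /= mulr1 mulrC.
  - by move=> t _ _; rewrite mulf_neq0 ?pnatr_eq0.
  - rewrite -[X in _ --> X](hadamard_num0 j).
    exact: is_derive_continuous (is_derive_hadamard_num j e00).
  - have := @exprn_continuous R j.+1 0; by rewrite /continuous_at expr0n.
  - have cF := is_derive_continuous (dFs j.+1 e00).
    apply: cvg_trans (cvgM cF (cvg_cst (j.+1%:R^-1 : R))).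
    apply: near_eq_cvg; near=> x => /=.
    by rewrite invfM mulrACA divff // mul1r.
apply: cvg_trans H; apply: near_eq_cvg; near=> x.
by rewrite hadamard_quotE //; near: x; exact: nbhs_dnbhs_neq.
Unshelve. all: by end_near. Qed.

(** Away from 0 this is the quotient rule; at 0 the candidate derivative is continuous, so
    [is_derive_limit] applies. *)
Lemma is_derive_hadamard_quot j t : `|t| < e -> is_derive t 1 (G j) (G j.+1 t).
Proof.
have off t' : `|t'| < e -> t' != 0 -> is_derive t' 1 (G j) (G j.+1 t').
  move=> te t0; rewrite (hadamard_quotE j.+1 t0) /=.
  have dE := is_derive_hadamard_num j te.
  have t1 : ((id : R -> R) ^+ j.+1) t' != 0 by rewrite exprfctE /= expf_neq0.
  apply: (@near_eq_is_derive _ _ _ (E j * (fun y => (((id : R -> R) ^+ j.+1) y)^-1))).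
    near=> x; rewrite !fctE hadamard_quotE //.
    near: x; apply: (cvgr_neq0 t') => //; exact: cvg_id.
  apply: is_derive_eq; rewrite !exprfctE /GRing.scale /= mulr1.
  rewrite (exprS t' j.+1) (exprS t' j).
  have a0 : t' ^+ j != 0 by rewrite expf_neq0.
  by field; rewrite a0 t0.
move=> te; have [->|] := eqVneq t 0; last exact: off.
by apply: (@is_derive_limit e) => //; exact: hadamard_quot_cont0.
Unshelve. all: by end_near. Qed.

End Hadamard.

(** Hadamard's lemma, with the functions [hadamard_quot Fs j] as the derivatives of the quotient. *)
Lemma smooth1_hadamard e F : 0 < e -> smooth1 e F -> F 0 = 0 ->
  exists G, [/\ smooth1 e G, G 0 = 'D_1 F 0 & forall t, F t = t * G t].
Proof.
move=> e0 [Fs [<- dFs]] F0; exists (hadamard_quot Fs 0); split.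
- by exists (hadamard_quot Fs); split=> // j t; exact: is_derive_hadamard_quot.
- have := dFs 0%N 0; rewrite normr0 => /(_ e0) d.
  by rewrite derive_val /hadamard_quot eqxx divr1.
- move=> t; rewrite /hadamard_quot; have [->|t0] := eqVneq t 0; first by rewrite mul0r.
  by rewrite /= mulrCA divff // mulr1.
Qed.

Definition even_on e F := forall t, `|t| < e -> F (- t) = F t.

Lemma derive_even e F t : smooth1 e F -> even_on e F -> `|t| < e ->
  'D_1 F (- t) = - 'D_1 F t.
Proof.
move=> [Fs [F0 dF]] evF te.
have dt := dF 0%N t te; have := dF 0%N (- t); rewrite normrN => /(_ te) dNt.
rewrite -F0 [in LHS]derive_val.
have dc : is_derive t 1 (Fs 0%N \o -%R) (Fs 1%N (- t) * -1) by apply: is_derive1_comp.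
suff -> : 'D_1 (Fs 0%N) t = 'D_1 (Fs 0%N \o -%R) t.
  by rewrite [in RHS]derive_val mulrN1 opprK.
apply: near_eq_derive; near=> x; rewrite /= F0 evF //.
by near: x; exact: near_normr_lt.
Unshelve. all: by end_near. Qed.

Lemma derive_even0 e F : 0 < e -> smooth1 e F -> even_on e F -> 'D_1 F 0 = 0.
Proof.
move=> e0 sF evF; have := derive_even sF evF; move=> /(_ 0).
rewrite normr0 oppr0 => /(_ e0) /eqP; rewrite -addr_eq0 -mulr2n -mulr_natl.
by rewrite mulf_eq0 pnatr_eq0 /= => /eqP.
Qed.

(** The derivative of an even function is odd, so it vanishes at 0 and Hadamard's lemma divides it
    by t; a quotient of odd functions is even. *)
Lemma smooth1_derive_even e F : 0 < e -> smooth1 e F -> even_on e F ->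
  exists G, [/\ smooth1 e G, even_on e G &
    forall t, `|t| < e -> is_derive t 1 F (t * G t)].
Proof.
move=> e0 sF evF; have [Fs [F0 dF]] := sF.
have DF t : `|t| < e -> 'D_1 F t = Fs 1%N t.
  by move=> te; have := dF 0%N t te; rewrite F0 => d; rewrite derive_val.
have F10 : Fs 1%N 0 = 0 by rewrite -DF ?normr0 // (derive_even0 e0 sF evF).
have sF1 : smooth1 e (Fs 1%N) by exists (fun j => Fs j.+1); split=> // j; exact: dF.
have [G [sG _ FG]] := smooth1_hadamard e0 sF1 F10.
exists G; split=> // [t te|t te]; last by rewrite -FG -F0; exact: dF.
have [->|t0] := eqVneq t 0; first by rewrite oppr0.
apply: (mulfI t0); rewrite -FG -DF // -[RHS]opprK -(derive_even sF evF te).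
by rewrite DF ?normrN // FG mulNr opprK.
Qed.

(** Hadamard's lemma is applied twice: the first quotient takes the value F'(0) at 0, which is 0 by
    evenness. *)
Lemma smooth1_taylor_even e F : 0 < e -> smooth1 e F -> even_on e F ->
  exists G, [/\ smooth1 e G, even_on e G & forall t, F t = F 0 + t ^+ 2 * G t].
Proof.
move=> e0 sF evF; have [Fs [F0 dF]] := sF.
pose F1 := F - cst (F 0).
have sF1 : smooth1 e F1.
  exists (fun j => if j is 0%N then F1 else Fs j); split=> // -[|j] t te; last exact: dF.
  have := dF 0%N t te; rewrite F0 => d.
  by apply: is_derive_eq; rewrite subr0.
have F10 : F1 0 = 0 by rewrite /F1 !fctE subrr.
have [H [sH H0 FH]] := smooth1_hadamard e0 sF1 F10.
have evF1 : even_on e F1 by move=> t te; rewrite /F1 !fctE evF.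
rewrite (derive_even0 e0 sF1 evF1) in H0.
have [G [sG _ HG]] := smooth1_hadamard e0 sH H0.
have F1G t : F1 t = t ^+ 2 * G t by rewrite FH HG mulrA.
exists G; split=> // [t te|t]; last by rewrite -F1G /F1 !fctE subrKC.
have [->|t0] := eqVneq t 0; first by rewrite oppr0.
by apply: (mulfI (expf_neq0 2 t0)); rewrite -F1G -evF1 // F1G sqrrN.
Qed.

Lemma even_chain e F : 0 < e -> smooth1 e F -> even_on e F ->
  exists phi : nat -> R -> R, phi 0%N = F /\
    forall j t, `|t| < e -> is_derive t 1 (phi j) (t * phi j.+1 t).
Proof.
move=> e0 sF evF.
(* Smoothness and evenness travel with the function, so that the choice of a divided derivative can
   be iterated. *)
pose T := {G : R -> R | smooth1 e G /\ even_on e G}.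
have step (G : T) : {H : T | forall t, `|t| < e -> is_derive t 1 (sval G) (t * sval H t)}.
  apply: cid; case: G => G [sG evG] /=.
  have [H [sH evH GH]] := smooth1_derive_even e0 sG evG.
  by exists (exist _ H (conj sH evH)).
pose s j := iter j (fun G : T => sval (step G)) (exist _ F (conj sF evF)).
exists (fun j => sval (s j)); split=> // j.
exact: (svalP (step (s j))).
Qed.

End OneVariable.

(** * The Euclidean norm and smoothness of radial functions *)

Section Euclidean.
Context {R : realType} {n : nat}.
Implicit Types (x y v : 'rV[R]_n) (a : R).

Definition dotv x y : R := \sum_i x 0 i * y 0 i.

(** The norm [|x|] of row vectors is the maximum norm, which orthogonal maps do not preserve in
    general. *)
Definition enorm x : R := Num.sqrt (dotv x x).

Lemma dotvC x y : dotv x y = dotv y x.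
Proof. by apply: eq_bigr => i _; rewrite mulrC. Qed.

Lemma dotvE x y : x *m y^T = (dotv x y)%:M.
Proof.
apply/rowP => j; rewrite !ord1 !mxE eqxx; apply: eq_bigr => k _.
by rewrite !mxE.
Qed.

Lemma dotvZl a x y : dotv (a *: x) y = a * dotv x y.
Proof. by rewrite mulr_sumr; apply: eq_bigr => i _; rewrite mxE mulrA. Qed.

Lemma dotvBl x y v : dotv (x - y) v = dotv x v - dotv y v.
Proof. by rewrite -sumrB; apply: eq_bigr => i _; rewrite !mxE mulrBl. Qed.

Lemma dotvBr x y v : dotv v (x - y) = dotv v x - dotv v y.
Proof. by rewrite !(dotvC v) dotvBl. Qed.

Lemma dotv_ge0 x : 0 <= dotv x x.
Proof. by apply: sumr_ge0 => i _; rewrite -expr2 sqr_ge0. Qed.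

Lemma dotv0 x : dotv 0 x = 0.
Proof. by apply: big1 => i _; rewrite mxE mul0r. Qed.

Lemma dotv_eq0 x : (dotv x x == 0) = (x == 0).
Proof.
apply/eqP/eqP => [|->]; last exact: dotv0.
move=> /psumr_eq0P H; apply/rowP => i; rewrite mxE.
have /eqP := H (fun i _ => sqr_ge0 _) i isT.
by rewrite mulf_eq0 orbb => /eqP.
Qed.

Lemma enorm_sqr x : enorm x ^+ 2 = dotv x x.
Proof. by rewrite sqr_sqrtr // dotv_ge0. Qed.

Lemma enorm_ge0 x : 0 <= enorm x. Proof. exact: sqrtr_ge0. Qed.

Lemma enorm0 : enorm 0 = 0. Proof. by rewrite /enorm dotv0 sqrtr0. Qed.

Lemma enorm_eq0 x : (enorm x == 0) = (x == 0).
Proof. by rewrite -dotv_eq0 -enorm_sqr sqrf_eq0. Qed.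

Lemma enormZ a x : enorm (a *: x) = `|a| * enorm x.
Proof.
by rewrite /enorm dotvZl dotvC dotvZl mulrA -expr2 sqrtrM ?sqr_ge0 // sqrtr_sqr.
Qed.

Lemma coord_le_norm x i : `|x 0 i| <= `|x|.
Proof.
rewrite [leRHS]/Num.Def.normr /= mx_normrE.
exact: (le_bigmax _ (fun ij : 'I_1 * 'I_n => `|x ij.1 ij.2|) (0, i)).
Qed.

Lemma norm_le_enorm x : `|x| <= enorm x.
Proof.
rewrite [leLHS]/Num.Def.normr /= mx_normrE; apply: bigmax_le; first exact: enorm_ge0.
move=> [i j] _ /=; rewrite ord1 -sqrtr_sqr ler_sqrt ?dotv_ge0 //.
rewrite /dotv (bigD1 j) //= -expr2 lerDl.
by apply: sumr_ge0 => k _; rewrite -expr2 sqr_ge0.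
Qed.

Lemma enorm_le_norm x : enorm x <= n%:R * `|x|.
Proof.
have n0 : 0 <= n%:R * `|x| by rewrite mulr_ge0.
rewrite -(ger0_norm n0) -sqrtr_sqr ler_sqrt ?sqr_ge0 //.
apply: (@le_trans _ _ (\sum_(i < n) `|x| ^+ 2)).
  apply: ler_sum => i _; rewrite -expr2 -real_normK ?num_real //.
  by rewrite lerXn2r ?nnegrE // coord_le_norm.
rewrite sumr_const card_ord exprMn -[X in _ <= X * _]natrX -[leLHS]mulr_natl.
rewrite ler_wpM2r ?sqr_ge0 // ler_nat.
by case: (n) => // m; rewrite expnS leq_pmulr.
Qed.

Lemma is_derive_coord x v i : is_derive x v (fun y => y 0 i) (v 0 i).
Proof.
apply: DeriveDef; first exact/diff_derivable/differentiable_coord.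
by have /matrixP/(_ 0 i) := derive_mx (derivable_id (x := x) (v := v)); rewrite derive_id mxE.
Qed.

Lemma differentiable_sqr_enorm x : differentiable (fun y => dotv y y) x.
Proof.
have -> : (fun y => dotv y y) = \sum_i ((fun y => y 0 i) * (fun y => y 0 i)).
  by apply/funext => y; rewrite fct_sumE.
by apply: differentiable_sum => i; apply: differentiableM; exact: differentiable_coord.
Qed.

Lemma derive_sqr_enorm x v : 'D_v (fun y => dotv y y) x = 2 * dotv x v.
Proof.
have -> : (fun y => dotv y y) = \sum_i ((fun y => y 0 i) * (fun y => y 0 i)).
  by apply/funext => y; rewrite fct_sumE.
have d i : is_derive x v ((fun y => y 0 i) * (fun y => y 0 i)) (2 * (x 0 i * v 0 i)).
  have di := is_derive_coord x v i.
  by apply: is_derive_eq; rewrite /GRing.scale /=; ring.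
have ds := is_derive_sum (fun i => d i).
by rewrite derive_val mulr_sumr.
Qed.

Lemma enorm_continuous : continuous enorm.
Proof.
move=> x; apply: (@continuous_comp _ _ _ (fun y => dotv y y) Num.sqrt).
  exact/differentiable_continuous/differentiable_sqr_enorm.
exact: sqrt_continuous.
Qed.

Lemma enorm_open (e : R) : open [set x | enorm x < e].
Proof.
apply: (@open_comp _ _ enorm [set t | t < e]) => [x _|]; last exact: open_lt.
exact: enorm_continuous.
Qed.

Lemma enorm_ball (U : set 'rV[R]_n) : nbhs (0 : 'rV[R]_n) U ->
  exists2 e, 0 < e & forall x, enorm x < e -> U x.
Proof.
move=> /nbhs_ballP[e /= e0 eU]; exists e => // x xe; apply: eU.
by rewrite -ball_normE /= sub0r normrN; exact: le_lt_trans (norm_le_enorm x) xe.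
Qed.

(** The norm need not be differentiable at 0, but f'(0) = 0 makes f |x| - f 0 negligible against
    |x|. *)
Lemma is_diff0_enorm (f : R -> R) : is_derive (0 : R) 1 f 0 ->
  is_diff (0 : 'rV[R]_n) (f \o enorm) 0.
Proof.
move=> df.
have Eo : (f \o enorm) \o shift 0 = cst ((f \o enorm) 0) + \0 +o_ (0 : 'rV[R]_n) id.
  apply/eqaddoP => _/posnumP[eps].
  have /diff_locally : differentiable f 0 by case: df => /derivable1_diffP.
  (* The divisor n + 1 absorbs the factor n of [enorm_le_norm] and stays nonzero when n = 0. *)
  have n1 : 0 < eps%:num / n.+1%:R by rewrite divr_gt0.
  move=> /eqaddoP/(_ _ n1) H.
  have dfE u : 'd f 0 u = 0.
    by rewrite deriv1E ?derive1E ?derive_val ?scaler0 //; case: df.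
  have /= := @enorm_continuous 0; rewrite /continuous_at enorm0 => /(_ _ H) {}H.
  near=> x; rewrite !fctE /= addr0 addr0.
  have : `|f (enorm x + 0) - (f 0 + 'd f 0 (enorm x))| <= eps%:num / n.+1%:R * `|enorm x|.
    by near: x; exact: H.
  rewrite dfE !addr0 => /le_trans; apply.
  rewrite -mulrA ler_pM2l // ler_pdivrMl // ger0_norm ?enorm_ge0 //.
  by apply: le_trans (enorm_le_norm x) _; rewrite ler_wpM2r // ler_nat.
have d0 : 'd (f \o enorm) (0 : 'rV[R]_n) = (\0 : {linear 'rV[R]_n -> R}) :> ('rV[R]_n -> R).
  by apply: diff_unique => //; exact: cst_continuous.
by apply: DiffDef => //; apply/diff_locallyP; rewrite d0; split => //; exact: cst_continuous.
Unshelve. all: by end_near. Qed.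

Section RadialChain.
Variables (e : R) (phi : nat -> R -> R).
Hypothesis e0 : 0 < e.
Hypothesis dphi : forall j (t : R), `|t| < e -> is_derive t 1 (phi j) (t * phi j.+1 t).

(** Off 0 the function is [phi j] after the square root, composed with the polynomial |x|^2; the
    derivative 1 / (2 |x|) of the root cancels the factor t in [dphi]. At 0 both sides of the
    formula vanish. *)
Lemma derive_radial j x : enorm x < e ->
  differentiable (phi j \o enorm) x /\
  forall v, 'D_v (phi j \o enorm) x = dotv x v * phi j.+1 (enorm x).
Proof.
move=> xe; have [->|x0] := eqVneq x 0.
  have d : is_derive (0 : R) 1 (phi j) 0.
    by have := @dphi j 0; rewrite normr0 mul0r; apply.
  have df := is_diff0_enorm d.
  by split=> // v; rewrite deriveE // diff_val dotv0 mul0r.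
have s0 : 0 < dotv x x by rewrite lt0r dotv_eq0 x0 dotv_ge0.
have ds : is_derive (dotv x x) 1 (phi j \o Num.sqrt) (phi j.+1 (enorm x) / 2).
  have d1 := is_derive1_sqrt s0.
  have d2 : is_derive (Num.sqrt (dotv x x)) 1 (phi j) (enorm x * phi j.+1 (enorm x)).
    by apply: dphi; rewrite ger0_norm ?enorm_ge0.
  apply: is_derive_eq; rewrite -/(enorm x).
  have en0 : enorm x != 0 by rewrite enorm_eq0.
  by rewrite /GRing.scale /=; field; rewrite en0.
have dfs : differentiable (phi j \o Num.sqrt) (dotv x x) by case: ds => /derivable1_diffP.
have dn := differentiable_sqr_enorm x.
have dc : differentiable ((phi j \o Num.sqrt) \o (fun y => dotv y y)) x.
  exact: differentiable_comp.
split=> [//|v].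
rewrite -[phi j \o enorm]/((phi j \o Num.sqrt) \o (fun y => dotv y y)) deriveE //.
rewrite diff_comp //= -(deriveE v dn) derive_sqr_enorm.
rewrite deriv1E; last by case: ds.
rewrite derive1E derive_val /GRing.scale /=; by field.
Qed.

(** The induction on k treats all j at once, since a derivative of the j-th function is a linear
    form times the next one. *)
Lemma Ck_radial k j : Ck k [set x | enorm x < e] (phi j \o enorm).
Proof.
elim: k j => [|k IH] j /=.
  by move=> x /(derive_radial j)[/differentiable_continuous].
split=> [x /(derive_radial j)[]//|v].
have oe := @enorm_open e.
have : Ck k [set x | enorm x < e] (fun x => dotv x v * phi j.+1 (enorm x)).
  apply: (Ck_scale (V := R^o)) (IH j.+1) => //.
  have : Ck k [set x | enorm x < e] (fun x => \sum_i v 0 i * x 0 i).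
    apply: Ck_sum => // i; apply: (Ck_scale (V := R^o)) => //; first exact: Ck_cst.
    by apply: Ck_coord => //; exact: Ck_id.
  apply: Ck_ext => // x _; exact: dotvC.
by apply: Ck_ext => // x /(derive_radial j)[_ ->].
Qed.

End RadialChain.

Lemma smooth_radial (e : R) (F : R -> R) : 0 < e -> smooth1 e F -> even_on e F ->
  smooth_on (V := R^o) [set x | enorm x < e] (F \o enorm).
Proof.
move=> e0 sF evF k; have [phi [<- dphi]] := even_chain e0 sF evF.
exact: Ck_radial.
Qed.

End Euclidean.

(** * Plots and smooth maps of a quotient diffeology *)

Section QuotientMaps.
Local Open Scope quotient_scope.
Context {R : realType} (T : choiceType) (d : diffeology R T) (eqv : equiv_rel T).
Local Notation Q := (quot_dflg d eqv).
Local Notation pi := (fun x : T => \pi_({eq_quot eqv}) x : Q).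

Lemma plot_pi n (U : set 'rV[R]_n) (q : 'rV[R]_n -> T) :
  plot d U q -> plot Q U (fun u => pi (q u)).
Proof.
move=> pq; split; first exact: plot_open pq.
by move=> u Uu; exists U, q; split.
Qed.

(** Plots of a quotient lift locally and being a plot is a local property, so smoothness can be
    tested on lifted plots. *)
Lemma smooth_in_quot (Y : dflgType R) (A : set Q) (g : Q -> Y) :
  (forall n (U : set 'rV[R]_n) (q : 'rV[R]_n -> T), plot d U q ->
    (forall u, U u -> A (pi (q u))) -> plot Y U (fun u => g (pi (q u)))) ->
  smooth_in A g.
Proof.
move=> H n U p [oU pU] pA; apply: plot_local => // u Uu.
have [U' [q [U'u U'U pq pE]]] := pU u Uu; exists U'; split=> //.
apply: plot_ext (H _ _ _ pq _) => w U'w /=; first by rewrite pE.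
by rewrite -pE //; exact/pA/U'U.
Qed.

End QuotientMaps.

(** * Orbits of the orthogonal group, classified by the norm *)

Section Orbits.
Local Open Scope quotient_scope.
Context {R : realType}.

Definition orb {n} (x : 'rV[R]_n) : orbit_space R n :=
  \pi_({eq_quot (orbit_equiv R n)}) x.

Definition orbit_norm {n} (y : orbit_space R n) : R :=
  enorm (repr (y : {eq_quot (orbit_equiv R n)})).

Lemma orb_repr n (y : orbit_space R n) : exists x, y = orb x.
Proof. by exists (repr (y : {eq_quot (orbit_equiv R n)})); rewrite /orb reprK. Qed.

(* A reflection along x - y maps x to y when x and y have the same norm. *)
Lemma orbP n (x y : 'rV[R]_n) : orb x = orb y <-> enorm x = enorm y.
Proof.
split=> [/eqmodP/asboolP[A oA ->]|xy].
  rewrite /enorm; congr Num.sqrt; move: (dotvE (x *m A^T) (x *m A^T)).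
  rewrite trmx_mul trmxK -mulmxA (mulmxA A^T) oA mul1mx dotvE.
  by move=> /matrixP/(_ 0 0); rewrite !mxE eqxx.
apply/eqmodP/asboolP.
have [->|xNy] := eqVneq x y.
  by exists 1%:M; rewrite /orthogonal_mx ?trmx1 mulmx1.
have {}xy : dotv x x = dotv y y by rewrite -!enorm_sqr xy.
have [w wE] : exists w, w = x - y by exists (x - y).
have [c cE] : exists c, c = dotv w w by exists (dotv w w).
have c0 : c != 0 by rewrite cE dotv_eq0 wE subr_eq0.
have ww : w *m w^T = c%:M by rewrite cE dotvE.
pose A := 1%:M - (2 / c) *: (w^T *m w).
have tA : A^T = A.
  by rewrite /A linearB linearZ /= trmx1 trmx_mul trmxK.
exists A.
  rewrite /orthogonal_mx tA /A mulmxBl mul1mx mulmxBr mulmx1 -scalemxAl -scalemxAr.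
  have -> : w^T *m w *m (w^T *m w) = c *: (w^T *m w).
    by rewrite mulmxA -(mulmxA w^T) ww mul_mx_scalar -scalemxAl.
  rewrite !scalerA; set a := 2 / c; have -> : a * a * c = a *+ 2.
    by rewrite /a mulr2n; field.
  by rewrite mulr2n scalerDl opprB addrK subrK.
rewrite tA mulmxBr mulmx1 -scalemxAr mulmxA dotvE mul_scalar_mx scalerA.
have -> : dotv x w = c / 2.
  by rewrite cE wE dotvBl !dotvBr -xy (dotvC y x); field.
have -> : 2 / c * (c / 2) = 1 by field.
by rewrite scale1r wE subKr.
Qed.

Lemma orbit_norm_orb n (x : 'rV[R]_n) : orbit_norm (orb x) = enorm x.
Proof. by apply/orbP; rewrite /orb reprK. Qed.

Lemma plot_orb n k (U : set 'rV[R]_k) (q : 'rV[R]_k -> 'rV[R]_n) :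
  open U -> smooth_on U q -> plot (orbit_space R n) U (orb \o q).
Proof. by move=> oU sq; exact: plot_pi. Qed.

End Orbits.

(** * The D-topology and germs of smooth functions on the orbit space *)

Section OrbitGerms.
Context {R : realType} {n : nat}.
Local Notation H := (orbit_space R n).
Local Notation smooth_real := (smooth_near (Y := std_dflg R^o) (basept H)).
Implicit Types (x : 'rV[R]_n) (y : H) (e : R).

Lemma orb0 : basept H = orb 0. Proof. by []. Qed.

Lemma orbit_norm0 : orbit_norm (basept H) = 0.
Proof. by rewrite orb0 orbit_norm_orb enorm0. Qed.

(** Together with [open_orb], this identifies the D-topology with the quotient topology: locally a
    plot is [orb] after a smooth, hence continuous, map. *)
Lemma D_open_orb (A : set H) : open [set x | A (orb x)] -> D_open A.
Proof.
move=> oA k U p [oU pU]; rewrite openE => u [Uu Apu].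
have [U' [q [U'u U'U [oU' sq] pE]]] := pU u Uu.
have := smooth_open_preimage oU' sq oA; rewrite openE => /(_ u).
case=> [|e /= e0 eA]; first by split=> //=; move: Apu; rewrite /= pE.
exists e => //= w /eA[/= U'w Aw]; split; first exact: U'U.
by rewrite /= pE.
Qed.

Lemma open_orb (A : set H) : D_open A -> open [set x | A (orb x)].
Proof.
move=> oA; have := oA n setT orb; rewrite setTI; apply.
by apply: (plot_orb (q := id)); [exact: openT|move=> k; exact: Ck_id].
Qed.

Lemma D_nbhs_orbit_norm e : 0 < e -> D_nbhs (basept H) [set y | orbit_norm y < e].
Proof.
move=> e0; split; last by rewrite /= orbit_norm0.
apply: D_open_orb; rewrite (_ : [set _ | _] = [set x | enorm x < e]); first exact: enorm_open.
by apply/funext => x /=; rewrite orbit_norm_orb.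
Qed.

(** With [D_nbhs_orbit_norm], the norm balls form a basis of neighbourhoods of the base point, so
    germs can be compared on balls. *)
Lemma orbit_norm_nbhs (A : set H) : D_nbhs (basept H) A ->
  exists2 e, 0 < e & forall y, orbit_norm y < e -> A y.
Proof.
move=> [oA A0]; have /enorm_ball[e e0 eA] : nbhs (0 : 'rV[R]_n) [set x | A (orb x)].
  by apply: open_nbhs_nbhs; split => //; exact: open_orb.
by exists e => // y; have [x ->] := orb_repr y; rewrite orbit_norm_orb => /eA.
Qed.

Lemma smooth_orb (A : set H) (g : H -> R) : D_open A ->
  smooth_in (Y := std_dflg R^o) A g ->
  smooth_on (V := R^o) [set x | A (orb x)] (g \o orb).
Proof.
move=> oA sg; have oU := open_orb oA.
by case: (sg n [set x | A (orb x)] orb) => //; apply: (plot_orb (q := id)) => // k; exact: Ck_id.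
Qed.

Lemma local_map_continuous (g : local_map (basept H) (std_dflg R^o)) :
  (g \o orb) x @[x --> (0 : 'rV[R]_n)] --> (g (basept H) : R^o).
Proof.
have [A [oA A0] sg] := local_mapP g.
exact: (smooth_orb oA sg 0%N 0 A0).
Qed.

Lemma smooth_near_radial e (G : R -> R) : 0 < e -> smooth1 e G -> even_on e G ->
  smooth_real (fun y => G (orbit_norm y)).
Proof.
move=> e0 sG evG; exists [set y | orbit_norm y < e]; first exact: D_nbhs_orbit_norm.
apply: smooth_in_quot => k U q [oU sq] qe; split=> // j.
apply: (@Ck_ext _ _ _ _ _ ((G \o enorm) \o q)) => // [u Uu|].
  by rewrite /= -orbit_norm_orb.
apply: (Ck_comp oU (enorm_open (e := e)) _ (sq j)) => [u Uu|].
  by have := qe u Uu; rewrite /= [orbit_norm _]orbit_norm_orb.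
exact: smooth_radial.
Qed.

Lemma smooth1_sqr e : smooth1 e (fun t => t ^+ 2).
Proof.
pose Fs j (t : R) : R :=
  match j with 0%N => t ^+ 2 | 1%N => 2 * t | 2%N => 2 | _ => 0 end.
exists Fs; split=> // -[|[|[|j]]] t _ /=.
- have -> : Fs 0%N = (id : R -> R) ^+ 2 by apply/funext => u; rewrite fctE.
  by apply: is_derive_eq; rewrite /GRing.scale /= mulr1 expr1.
- have -> : Fs 1%N = 2 *: (id : R -> R) by apply/funext => u; rewrite fctE.
  by apply: is_derive_eq; rewrite /GRing.scale /= mulr1.
- exact: is_derive_cst.
- exact: is_derive_cst.
Qed.

Lemma smooth_near_sqr_norm : smooth_real (fun y => orbit_norm y ^+ 2).
Proof.
apply: (@smooth_near_radial 1 (fun t => t ^+ 2)) => //; first exact: smooth1_sqr.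
by move=> t _; rewrite sqrrN.
Qed.

(** The germ of r = |x|^2; for n > 0 it generates the ideal of germs vanishing at the base point, by
    [germ_taylor]. *)
Definition sqr_germ : germ_alg H := germ_of (LocalMap smooth_near_sqr_norm).

Hypothesis n_gt0 : (0 < n)%N.

Lemma unit_vector : exists u : 'rV[R]_n, enorm u = 1.
Proof.
pose i := Ordinal n_gt0; exists (delta_mx 0 i); rewrite /enorm /dotv (bigD1 i) //=.
rewrite big1 => [|j ji]; first by rewrite !mxE !eqxx mulr1 addr0 sqrtr1.
by rewrite !mxE (negbTE ji) andbF mulr0.
Qed.

(** The derivatives on the line are iterated directional derivatives of f along u; the radius stays
    [e] because u is a unit vector. *)
Lemma smooth1_line (U : set 'rV[R]_n) (f : 'rV[R]_n -> R) u e : enorm u = 1 ->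
  (forall x, enorm x < e -> U x) -> smooth_on (V := R^o) U f ->
  smooth1 e (fun t => f (t *: u)).
Proof.
move=> u1 eU sf.
pose h j : 'rV[R]_n -> R^o := iter j (fun f => 'D_u f) (f : _ -> R^o).
have sh j : smooth_on U (h j).
  by elim: j => [//|j IH] k; have [_] := IH k.+1; apply.
exists (fun j t => h j (t *: u)); split=> // j t te.
have Utu : U (t *: u) by apply: eU; rewrite enormZ u1 mulr1.
have [/(_ _ Utu)/diff_derivable-/(_ u) dh _] := sh j 1%N.
have E : (fun s : R => s^-1 *: (((fun t => h j (t *: u)) \o shift t) (s *: 1) - h j (t *: u)))
    = (fun s : R => s^-1 *: ((h j \o shift (t *: u)) (s *: u) - h j (t *: u))).
  by apply/funext => s /=; rewrite [s *: 1]mulr1 scalerDl.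
by split; rewrite /derivable /derive E.
Qed.

(** Norms classify orbits, so g is determined by its restriction to the line through a unit vector
    u, and this restriction is even because t u and - t u lie in one orbit. *)
Lemma orbit_taylor (g : local_map (basept H) (std_dflg R^o)) :
  exists e G, [/\ 0 < e, smooth1 e G, even_on e G & forall y, orbit_norm y < e ->
    g y = g (basept H) + orbit_norm y ^+ 2 * G (orbit_norm y) :> R].
Proof.
have [A [oA A0] sg] := local_mapP g.
have [e e0 eA] := orbit_norm_nbhs (conj oA A0).
have [u u1] := unit_vector.
pose F t : R := g (orb (t *: u)).
have sF : smooth1 e F.
  apply: smooth1_line u1 _ (smooth_orb oA sg) => x xe.
  by apply: eA; rewrite orbit_norm_orb.
have evF : even_on e F.
  by move=> t _; rewrite /F; congr (g _); apply/orbP; rewrite !enormZ normrN.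
have [G [sG evG FG]] := smooth1_taylor_even e0 sF evF.
exists e, G; split=> // y _; have [x ->] := orb_repr y; rewrite orbit_norm_orb.
have := FG (enorm x); rewrite /F scale0r => <-; congr (g _).
by apply/orbP; rewrite enormZ u1 mulr1 ger0_norm ?enorm_ge0.
Qed.

End OrbitGerms.

(** * Values of germs and evaluation of derivations *)

Section GermValues.
Context {R : realType} {X : based R}.
Implicit Types (a b : germ_alg X) (c : R) (D : rtangent X).

Lemma germ_valD a b : germ_val (a + b) = germ_val a + germ_val b :> R.
Proof.
elim/germ_ind: a => f; elim/germ_ind: b => g.
by rewrite [_ + _ in LHS]germ_addE !germ_val_of.
Qed.

Lemma germ_valM a b : germ_val (a * b) = germ_val a * germ_val b :> R.
Proof.
elim/germ_ind: a => f; elim/germ_ind: b => g.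
by rewrite [_ * _ in LHS]germ_mulE !germ_val_of.
Qed.

Lemma germ_valZ c a : germ_val (c *: a) = c * germ_val a :> R.
Proof.
elim/germ_ind: a => f.
by rewrite [_ *: _]germ_mulE !germ_val_of.
Qed.

Lemma germ_val1 : germ_val (1 : germ_alg X) = 1 :> R.
Proof. by rewrite germ_val_of. Qed.

Lemma rtangentZD D c a b : D (c *: a + b) = c * D a + D b :> R.
Proof. by have /asboolP[lD _] := rt_funP D; rewrite lD. Qed.

Lemma rtangentM D a b : D (a * b) = germ_val a * D b + germ_val b * D a :> R.
Proof. by have /asboolP[_ ->] := rt_funP D. Qed.

Lemma rtangent1 D : D 1 = 0 :> R.
Proof.
have := rtangentM D 1 1; rewrite mulr1 germ_val1 mul1r => /eqP.
by rewrite -subr_eq subrr eq_sym => /eqP.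
Qed.

End GermValues.

(** To first order in s the coefficients obey the Leibniz rule, which is what makes the coefficient
    of s a derivation. *)
Lemma mul_taylor (R : comNzRingType) (A : comAlgType R) (a b : R) (s k l : A) :
  (a%:A + s * k) * (b%:A + s * l) = (a * b)%:A + s * (a *: l + b *: k + s * (k * l)).
Proof.
have -> : (a * b)%:A = a%:A * b%:A :> A by rewrite mulr_algl scalerA.
rewrite -(mulr_algl a l) -(mulr_algl b k); ring.
Qed.

(** * The right tangent space of an orbit space at its base point *)

Section OrbitTangent.
Context {R : realType} {n : nat}.
Local Notation H := (orbit_space R n).
Local Notation s := (sqr_germ : germ_alg H).
Hypothesis n_gt0 : (0 < n)%N.
Implicit Types g k : germ_alg H.

Lemma germ_val_sqr : germ_val s = 0 :> R.
Proof. by rewrite germ_val_of /= orbit_norm0 expr0n. Qed.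

Lemma germ_taylor g : exists k, g = (germ_val g)%:A + s * k.
Proof.
elim/germ_ind: g => f; rewrite germ_val_of.
have [e [G [e0 sG evG fG]]] := orbit_taylor n_gt0 f.
exists (germ_of (LocalMap (smooth_near_radial e0 sG evG))).
rewrite [s * _]germ_mulE [_%:A]germ_mulE [_ + _]germ_addE.
apply/germ_ofP; exists [set y | orbit_norm y < e]; first exact: D_nbhs_orbit_norm.
by move=> y /= /fG ->; rewrite mulr1.
Qed.

(** If k were nonzero at the base point, it would be so on a small ball by continuity; at a point t
    u of that ball with t > 0, r = t^2 is nonzero as well. *)
Lemma sqr_germ_mul_eq0 k : s * k = 0 -> germ_val k = 0 :> R.
Proof.
elim/germ_ind: k => f; rewrite germ_val_of [s * _]germ_mulE => /germ_ofP[A nA fA].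
have [e e0 eA] := orbit_norm_nbhs nA.
have [u u1] := unit_vector (R := R) n_gt0.
apply: contrapT => /eqP f0.
have /cvgr_neq0/(_ f0) := @local_map_continuous _ _ f.
move=> /enorm_ball[d d0 df].
have [t [t0 te td]] : exists t : R, [/\ 0 < t, t < e & t < d].
  have m0 : 0 < Num.min e d by rewrite lt_min e0 d0.
  have mm : Num.min e d / 2 < Num.min e d by rewrite ltr_pdivrMr // ltr_pMr // ltr1n.
  by exists (Num.min e d / 2); split; first exact: divr_gt0;
    apply: lt_le_trans mm _; rewrite ge_min lexx ?orbT.
have tu : enorm (t *: u) = t by rewrite enormZ u1 mulr1 gtr0_norm.
have /fA/eqP : A (orb (t *: u)) by apply: eA; rewrite orbit_norm_orb tu.
rewrite /= orbit_norm_orb tu mulf_eq0 expf_eq0 /= (gt_eqF t0) /=.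
by apply/negP/df; rewrite tu.
Qed.

Lemma germ_val_taylor c k : germ_val (c%:A + s * k) = c :> R.
Proof.
by rewrite germ_valD (germ_valM s) germ_val_sqr mul0r addr0 germ_valZ germ_val1 mulr1.
Qed.

(** This makes [radial_derivation] independent of the expansion chosen in its definition. *)
Lemma germ_taylor_inj c c' k k' :
  c%:A + s * k = c'%:A + s * k' -> germ_val k = germ_val k' :> R.
Proof.
move=> E; have := congr1 (fun g => germ_val g : R) E.
rewrite !germ_val_taylor => cc.
move: E; rewrite cc => /addrI/eqP; rewrite -subr_eq0 -mulrBr => /eqP/sqr_germ_mul_eq0.
by rewrite germ_valD -scaleN1r germ_valZ mulN1r => /eqP; rewrite subr_eq0 => /eqP.
Qed.

Lemma rtangent_taylor (D : rtangent H) c k : D (c%:A + s * k) = germ_val k * D s.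
Proof.
by rewrite rtangentZD rtangent1 mulr0 add0r rtangentM germ_val_sqr mul0r add0r.
Qed.

(** On the germ of F |x| with F smooth and even, this is F''(0) / 2. *)
Definition radial_derivation g : R^o := germ_val (sval (cid (germ_taylor g))).

Lemma radial_derivationE c k : radial_derivation (c%:A + s * k) = germ_val k.
Proof.
rewrite /radial_derivation; case: cid => k' /= /esym; exact: germ_taylor_inj.
Qed.

Lemma radial_derivationP : radial_derivation \in @derivation_pred R H.
Proof.
apply/asboolP; split=> [c g h|g h].
  have [[k gE] [l hE]] := (germ_taylor g, germ_taylor h).
  rewrite gE hE.
  have -> : c *: ((germ_val g)%:A + s * k) + ((germ_val h)%:A + s * l) =
     (c * germ_val g + germ_val h)%:A + s * (c *: k + l).
    by rewrite scalerDr scalerA scalerDl mulrDr scalerAr addrACA.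
  by rewrite !radial_derivationE germ_valD germ_valZ.
have [[k gE] [l hE]] := (germ_taylor g, germ_taylor h).
have E : g * h = (germ_val g * germ_val h)%:A +
    s * (germ_val g *: l + germ_val h *: k + s * (k * l)).
  by rewrite [in LHS]gE [in LHS]hE mul_taylor.
have Dg : radial_derivation g = germ_val k by rewrite gE radial_derivationE.
have Dh : radial_derivation h = germ_val l by rewrite hE radial_derivationE.
rewrite E radial_derivationE Dg Dh.
by rewrite !germ_valD !germ_valZ (germ_valM s) germ_val_sqr mul0r addr0.
Qed.

Definition radial_tangent : rtangent H := RTangent radial_derivationP.

Lemma radial_tangent_sqr : radial_tangent s = 1.
Proof.
have -> : s = 0%:A + s * 1 by rewrite scale0r add0r mulr1.
by rewrite /= radial_derivationE germ_val1.
Qed.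

(** Evaluation at r is thus injective on tangent vectors, which bounds the dimension by one. *)
Lemma rtangent_sqr_eq0 (D : rtangent H) : D s = 0 -> D = 0.
Proof.
move=> D0; apply/val_inj/funext => g; have [k ->] := germ_taylor g.
by rewrite /= rtangent_taylor D0 mulr0.
Qed.

End OrbitTangent.

(** * Morphisms between orbit spaces and the pullback of r *)

Section OrbitMorphisms.
Context {R : realType} {m n : nat}.
Local Notation Hm := (orbit_space R m).
Local Notation Hn := (orbit_space R n).

Lemma precomp_sqr_germE (f : morphism Hm Hn) : exists g : local_map (basept Hm) (std_dflg R^o),
  precomp f sqr_germ = germ_of g /\
  forall y, g y = orbit_norm (germ_repr (mor_germ f) y) ^+ 2.
Proof. by eexists; split; first exact: precompE. Qed.

Definition pad (x : 'rV[R]_m) : 'rV[R]_n := x *m pid_mx m.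

Lemma enorm_pad x : (m <= n)%N -> enorm (pad x) = enorm x.
Proof.
move=> mn; congr Num.sqrt; have := dotvE (pad x) (pad x).
rewrite trmx_mul -mulmxA (mulmxA (pid_mx m)) tr_pid_mx mul_pid_mx minnn.
rewrite (minn_idPr mn) pid_mx_1 mul1mx dotvE => /matrixP/(_ 0 0).
by rewrite !mxE eqxx.
Qed.

Lemma Ck_pad k (U : set 'rV[R]_m) : open U -> Ck k U pad.
Proof.
move=> oU; have := @Ck_sum R k _ _ U m (fun i x => x 0 i *: row i (pid_mx m : 'M[R]_(m, n))) oU.
move=> H; apply: Ck_ext (H _) => // [x _|i]; first by rewrite /pad mulmx_sum_row.
by apply: Ck_scale => //; [apply: Ck_coord => //; exact: Ck_id|exact: Ck_cst].
Qed.

Definition inclusion (y : Hm) : Hn := orb (pad (repr (y : {eq_quot (orbit_equiv R m)}%qT))).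

(** Padding preserves norms and norms classify orbits, so the representative chosen in [inclusion]
    does not matter. *)
Lemma inclusion_orb x : (m <= n)%N -> inclusion (orb x) = orb (pad x).
Proof.
by move=> mn; apply/orbP; rewrite !enorm_pad // -[RHS]orbit_norm_orb.
Qed.

Lemma smooth_near_inclusion : (m <= n)%N -> smooth_near (basept Hm) inclusion.
Proof.
move=> mn; exists setT; first exact: D_nbhsT.
apply: smooth_in_quot => k U q [oU sq] _.
apply: plot_ext (@plot_orb R n k U (pad \o q) oU _) => [u _|j] /=.
  by rewrite -inclusion_orb.
by apply: (Ck_comp oU (@openT _) _ (sq j)) => //; exact: Ck_pad openT.
Qed.

Lemma exists_sqr_morphism : (m <= n)%N ->
  exists f : morphism Hm Hn, precomp f sqr_germ = sqr_germ.
Proof.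
move=> mn; pose h := LocalMap (smooth_near_inclusion mn).
have h0 : germ_val (germ_of h) = basept Hn.
  by rewrite germ_val_of [LHS](inclusion_orb 0 mn) /pad mul0mx.
exists (Morphism h0); have [g [-> gE]] := precomp_sqr_germE (Morphism h0).
have [A nA hA] := germ_repr_of h.
apply/germ_ofP; exists A => // y /hA; rewrite gE /= => ->.
have [x ->] := orb_repr y.
by rewrite /= inclusion_orb // !orbit_norm_orb enorm_pad.
Qed.

Lemma linear_kernel (L : {linear 'rV[R]_m -> 'rV[R]_n}) : (n < m)%N ->
  exists2 v, v != 0 & L v = 0.
Proof.
move=> nm; pose K := kermx (lin1_mx L).
have K0 : K != 0.
  rewrite kermx_eq0 /row_free neq_ltn; apply/orP; left.
  exact: leq_ltn_trans (rank_leq_col _) nm.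
exists (nz_row K); first by rewrite nz_row_eq0.
by rewrite -mul_rV_lin1; apply/sub_kermxP; exact: nz_row_sub.
Qed.

(** For a local lift q and a kernel vector v of its differential at 0, the limit of |q(t v) / t|^2
    as t tends to 0 is computed twice: as the squared norm of the derivative along v, which is 0,
    and through the factorization, as |v|^2 k(0). *)
Lemma precomp_sqr_germ_degenerate (f : morphism Hm Hn) (k : germ_alg Hm) :
  (n < m)%N -> precomp f sqr_germ = 0%:A + sqr_germ * k -> germ_val k = 0 :> R.
Proof.
move=> nm; elim/germ_ind: k => kappa; rewrite germ_val_of scale0r add0r.
have [g [-> gE]] := precomp_sqr_germE f.
rewrite [sqr_germ * _]germ_mulE => /germ_ofP[B nB gB].
set h := germ_repr (mor_germ f) in gE.
have [A nA sh] := local_mapP h.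
have [e e0 eAB] := orbit_norm_nbhs (D_nbhsI nA nB).
have oe := @enorm_open R m e.
have [_ ph] : plot Hn [set x : 'rV[R]_m | enorm x < e] (h \o orb).
  apply: sh; first by apply: (plot_orb (q := id)) => // k; exact: Ck_id.
  by move=> x xe; have [] := eAB (orb x); rewrite ?orbit_norm_orb.
(* A plot of the quotient is only guaranteed a smooth lift near each point, here near 0. *)
have [|U [q [U0 Ue [oU sq] hq]]] := ph 0; first by rewrite /= enorm0.
have qE x : U x -> enorm (q x) ^+ 2 = enorm x ^+ 2 * kappa (orb x) :> R.
  move=> Ux; have xe : orbit_norm (orb x) < e by rewrite orbit_norm_orb; exact: Ue.
  have [_ /gB] := eAB _ xe; rewrite gE [h (orb x)](hq x Ux) /= orbit_norm_orb => <-.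
  by rewrite [orbit_norm _]orbit_norm_orb.
have q0 : q 0 = 0.
  by apply/eqP; rewrite -enorm_eq0 -sqrf_eq0 qE // enorm0 expr0n mul0r.
have [/(_ _ U0) dq _] := sq 1%N.
have [v v0 Lv] := linear_kernel ('d q 0) nm.
have to0 : (t *: v) @[t --> (0 : R)] --> (0 : 'rV[R]_m).
  by have := @scalel_continuous _ _ v (0 : R); rewrite /continuous_at scale0r.
have lim0 : enorm (t^-1 *: q (t *: v)) ^+ 2 @[t --> (0 : R)^'] --> (0 : R).
  have : t^-1 *: q (t *: v) @[t --> (0 : R)^'] --> 'D_v q 0.
    have dv : derivable q 0 v by exact: diff_derivable.
    apply: cvg_trans dv; apply: near_eq_cvg; near=> t.
    by rewrite /= addr0 q0 subr0.
  rewrite deriveE // Lv => qt.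
  have : enorm (t^-1 *: q (t *: v)) @[t --> (0 : R)^'] --> enorm (0 : 'rV[R]_n).
    by apply: (continuous_cvg _ _ qt); exact: enorm_continuous.
  rewrite enorm0 => et; have := cvgM et et; rewrite mulr0; exact.
have limk : enorm (t^-1 *: q (t *: v)) ^+ 2 @[t --> (0 : R)^'] -->
    (enorm v ^+ 2 * kappa (basept Hm) : R).
  have ck : kappa (orb (t *: v)) @[t --> (0 : R)^'] --> (kappa (basept Hm) : R^o).
    exact: cvg_within_filter (cvg_comp _ _ to0 (@local_map_continuous _ _ kappa)).
  apply: cvg_trans (cvgM (cvg_cst (enorm v ^+ 2 : R)) ck); apply: near_eq_cvg; near=> t.
  have t0 : t != 0 by near: t; exact: nbhs_dnbhs_neq.
  have Utv : U (t *: v).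
    near: t; apply: cvg_within_filter to0 _ _; exact: open_nbhs_nbhs.
  rewrite enormZ exprMn qE // enormZ exprMn !real_normK ?num_real //.
  by rewrite /=; field.
have /esym/eqP : 0 = enorm v ^+ 2 * kappa (basept Hm) :> R.
  by apply: (cvg_unique _ lim0 limk); exact: norm_hausdorff.
rewrite mulf_eq0 sqrf_eq0 enorm_eq0 (negbTE v0) /= => /eqP; exact.
Unshelve. all: by end_near. Qed.

End OrbitMorphisms.

(** * Spans of pushforwards and the two cases of the theorem *)

Section RelativeTangentSpaces.
Context {R : realType}.

Lemma pushforward_orbit_eq0 (m n : nat) (f : morphism (orbit_space R m) (orbit_space R n))
    (D : rtangent (orbit_space R m)) :
  (0 < n)%N -> (n < m)%N -> pushforward f D = 0.
Proof.
move=> n0 nm; apply: (rtangent_sqr_eq0 n0).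
have m0 := leq_ltn_trans (leq0n n) nm.
have [k E] := germ_taylor m0 (precomp f sqr_germ).
(* The constant term of the pulled back r is the value of r at the base point, namely 0. *)
rewrite germ_val_precomp germ_val_sqr in E.
rewrite [LHS]/(D (precomp f sqr_germ)) E [LHS]rtangent_taylor.
by rewrite (precomp_sqr_germ_degenerate nm E) mul0r.
Qed.

Lemma lspan_eq0 (V : lmodType R) (S : set V) v :
  (forall w, S w -> w = 0) -> v \in lspan S -> v = 0.
Proof.
move=> S0 /asboolP[k [c [w [Sw ->]]]].
by apply: big1 => i _; rewrite (S0 _ (Sw i)) scaler0.
Qed.

Lemma mem_lspan (V : lmodType R) (S : set V) v : S v -> v \in lspan S.
Proof.
move=> Sv; apply/asboolP; exists 1%N, (fun=> 1), (fun=> v).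
by rewrite big_ord1 scale1r.
Qed.

End RelativeTangentSpaces.

Unset Implicit Arguments.

Theorem theorem3p7 (R : realType) (n m : nat) (hn : (1 <= n)%N) (hm : (1 <= m)%N) :
  if (m <= n)%N then
    lmod_iso (rel_rtangent (orbit_space R m) (orbit_space R n)) R^o
  else
    lmod_iso (rel_rtangent (orbit_space R m) (orbit_space R n)) 'rV[R]_0.
Proof.
case: leqP => [mn|nm].
- pose W := rel_rtangent (orbit_space R m) (orbit_space R n).
  (* The isomorphism is evaluation at r, injective already on the whole right tangent space. *)
  pose ev (D : W) : R^o := rrt_val D sqr_germ.
  have lev : linear ev by move=> c D E.
  pose evl : {linear W -> R^o} := HB.pack ev (GRing.isLinear.Build _ _ _ _ _ lev).
  have ev_inj : injective ev.
    move=> D E DE; apply/val_inj/subr0_eq/(rtangent_sqr_eq0 hn).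
    by rewrite -[LHS]/(ev D - ev E) DE subrr.
  have [f fs] := exists_sqr_morphism (R := R) mn.
  (* [f] pulls r back to r, so this pushforward takes the value 1 on r, and its multiples give the
     inverse map. *)
  have fT : pushforward f (radial_tangent hm) \in
      lspan (@pushforwards _ (orbit_space R m) (orbit_space R n)).
    by apply: mem_lspan; exists f, (radial_tangent hm).
  pose T : W := RelRTangent fT.
  have evT : ev T = 1 by rewrite /ev /= fs; exact: radial_tangent_sqr.
  have evZ c : ev (c *: T) = c.
    by rewrite -[ev]/(evl : W -> R^o) linearZ /= evT; exact: mulr1.
  exists evl; exists (fun c => c *: T) => [D|c] /=; last exact: evZ.
  by apply: ev_inj; rewrite evZ.
(* Every generator of the span is 0, so both spaces have a single element and the zero map is
   bijective. *)
- pose z := @GRing.null_fun (rel_rtangent (orbit_space R m) (orbit_space R n)) 'rV[R]_0.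
  exists z; exists (fun=> 0) => [D|v] /=; last by rewrite [v]thinmx0.
  apply/esym/val_inj/(lspan_eq0 _ (rrt_valP D)) => w [f [E ->]].
  exact: pushforward_orbit_eq0.
Qed.
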